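(* Let $(\mathcal{E},\mathcal{F})$ be a (not necessarily regular) Dirichlet form in $L^{2}(M,\mu)$. If condition $(\mathrm{VD})$ holds, then (with the conditions defined in the context) $$(\mathrm{wEH})\Leftrightarrow(\mathrm{wEH}1)\Leftrightarrow(\mathrm{wEH}2)\Leftrightarrow(\mathrm{wEH}3),$$ and each of these equivalent conditions implies $(\mathrm{wEH}4)$.
   Context: Metric measure space: $(M,d)$ is a locally compact separable metric space, $\mu$ a Radon measure on $M$ with full support, $B(x,r)=\{y\in M:d(x,y)<r\}$, $V(x,r)=\mu(B(x,r))$. Every ball is assumed precompact and comes with a fixed centre and radius; for $B=B(x,r)$ and $\lambda>0$, $\lambda B=B(x,\lambda r)$. $\overline R\in(0,\mathrm{diam}(M)]$ is fixed (possibly $\infty$). The map $w:M\times[0,\infty)\to[0,\infty)$ is such that $w(x,\cdot)$ is continuous, strictly increasing, $w(x,0)=0$ for each $x$, and there are constants $C_1,C_2>0$, $\beta_2\ge\beta_1>0$ with $C_1(R/r)^{\beta_1}\le w(x,R)/w(y,r)\le C_2(R/r)^{\beta_2}$ for all $0<r\le R<\infty$ and $x,y\in M$ with $d(x,y)\le R$. For $B=B(x,R)$ write $w(B)=w(x,R)$. Ess inf, ess sup and a.e. statements are with respect to $\mu$. Dirichlet form: $\mathcal F'=\{v+a:v\in\mathcal F,a\in\mathbb R\}$, and $\mathcal E$ is extended to $\mathcal F'$ by $\mathcal E(u+a,v+b):=\mathcal E(u,v)$ for $u,v\in\mathcal F$, $a,b\in\mathbb R$ (assumed well defined, as is the case for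 forms without killing part). For open $\Omega\subset M$, $\mathcal F(\Omega)$ is the closure of $\mathcal F\cap C_0(\Omega)$ in the norm $\sqrt{\mathcal E(u,u)+\|u\|_2^2}$, where $C_0(\Omega)$ is the set of continuous functions with compact support in $\Omega$. The form has a symmetric jump measure $J(dx,dy)=J(x,dy)\mu(dx)$ given by a transition kernel $J(x,E)$ on $M\times\mathcal B(M)$. A function $u\in\mathcal F'$ is $f$-superharmonic in $\Omega$ if $\mathcal E(u,\varphi)\ge(f,\varphi)$ ($L^2$ inner product) for all $0\le\varphi\in\mathcal F(\Omega)$. For open $U\Subset\Omega$ ($U$ precompact with $\overline U\subset\Omega$), $T_{U,\Omega}(v)=\operatorname{ess\,sup}_{x\in U}\int_{\Omega^c}|v(y)|J(x,dy)$; $u_-=\max(0,-u)$. For a ball $B$, $\omega_B(A)=\mu(A\cap B)/\mu(B)$. $(\mathrm{VD})$: there is $C_\mu\ge1$ with $V(x,2r)\le C_\mu V(x,r)$ for all $x\in M$, $r>0$. Below, $B_s=B(x_0,s)$ denotes balls with common centre $x_0\in M$, and $\mathcal T:=T_{\frac34B_R,B_R}(u_-)+\|f\|_{L^\infty(B_R)}$. $(\mathrm{wEH})$: there exist $p,\delta,\sigma\in(0,1)$, $C_H\ge1$ such that for all $x_0$, all $0<r\le\delta R$, $R<\sigma\overline R$, every $f\in L^\infty(B_R)$ and every $u\in\mathcal F'\cap L^\infty$ non-negative and $f$-superharmonic in $B_R$: $\big(\frac1{\mu(B_r)}\int_{B_r}u^pd\mu\big)^{1/p}\le C_H(\operatorname{ess\,inf}_{B_r}u+w(B_r)\mathcal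 T)$. $(\mathrm{wEH}1)$: there exist $\sigma\in(0,1)$, $\delta_1\in(0,1/4)$ and a function $\varepsilon_1:(0,1]\to(0,1)$ such that for all $x_0$, $R\in(0,\sigma\overline R)$, $r\in(0,\delta_1R)$, $f\in L^\infty(B_R)$, $\eta_1\in(0,1]$, every $u\in\mathcal F'\cap L^\infty$ non-negative and $f$-superharmonic in $B_R$, and every $a>0$: if $\omega_{B_r}(\{u\ge a\})\ge\eta_1$, then $\operatorname{ess\,inf}_{B_{4r}}u>\varepsilon_1(\eta_1)a-w(B_r)\mathcal T$. $(\mathrm{wEH}2)$: there exist $\sigma,\delta_2\in(0,1)$ and $C>0$ such that for all $x_0$, $R\in(0,\sigma\overline R)$, $r\in(0,\delta_2R)$, $a>0$, $f\in L^\infty(B_R)$ and every $u\in\mathcal F'\cap L^\infty$ non-negative and $f$-superharmonic in $B_R$: $\operatorname{ess\,inf}_{B_r}u\ge a\exp\big(-\frac{C}{\omega_{B_r}(\{u\ge a\})}\big)-w(B_r)\mathcal T$ (the exponential is $0$ if $\omega_{B_r}(\{u\ge a\})=0$). $(\mathrm{wEH}3)$: there exist $\sigma,\delta_3\in(0,1)$ and a map $F:(0,1]\to(0,1]$ such that for all $x_0$, $R\in(0,\sigma\overline R)$, $r\in(0,\delta_3R]$, $\eta_3\in(0,1]$, $f\in L^\infty(B_R)$, every $u\in\mathcal F'\cap L^\infty$ non-negative and $f$-superharmonic in $B_R$, and every $a>0$: if $\omega_{B_r}(\{u\ge a\})\ge\eta_3$ and $w(B_r)\mathcal T\le F(\eta_3)a$,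 then $\operatorname{ess\,inf}_{B_r}u\ge F(\eta_3)a$. $(\mathrm{wEH}4)$: there exist $\sigma,\varepsilon_4,\delta_4\in(0,1)$ such that for every ball $B_R$ with $R\in(0,\sigma\overline R)$, every $f\in L^\infty(B_R)$, every $u\in\mathcal F'\cap L^\infty$ non-negative and $f$-superharmonic in $B_R$, and every $a>0$: if $\omega_{\delta_4B_R}(\{u\ge a\})\ge\frac12$ and $w(\delta_4B_R)\mathcal T\le\varepsilon_4a$, then $\operatorname{ess\,inf}_{\frac12(\delta_4B_R)}u\ge\varepsilon_4a$. *)

(* Defs.v *)
From HB Require Import structures.
From mathcomp Require Import all_boot all_order all_algebra.
From mathcomp Require Import all_classical all_reals all_analysis.

Set Implicit Arguments.
Unset Strict Implicit.
Unset Printing Implicit Defensive.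

Import Order.TTheory GRing.Theory Num.Theory.
Import numFieldNormedType.Exports.

Local Open Scope classical_set_scope.
Local Open Scope ring_scope.

#[short(type="metricMeasurableType")]
HB.structure Definition MetricMeasurable (R : numDomainType) d :=
  { M of Metric R M & Measurable d M }.

Section metric_measure.
Context {R : realType} {d : measure_display} {M : metricMeasurableType R d}.
Variable mu : {measure set M -> \bar R}.

Record radon_measure : Prop := {
  radon_compact : forall A : set M, compact A -> (mu A < +oo)%E ;
  radon_outer : forall A : set M, measurable A ->
    mu A = ereal_inf [set mu U | U in [set U : set M | open U /\ A `<=` U]] ;
  radon_inner : forall U : set M, open U ->
    mu U = ereal_sup [set mu A | A in [set A : set M | compact A /\ A `<=` U]]
}.

Record metric_measure_space : Prop := {
  mms_borel : @measurable d M = <<s [set U : set M | open U] >> ;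
  mms_locally_compact : locally_compact [set: M] ;
  mms_separable : exists2 D : set M, countable D & dense D ;
  mms_radon : radon_measure ;
  mms_full_support : forall U : set M, open U -> U !=set0 -> (0 < mu U)%E ;
  mms_precompact_ball : forall (x : M) (r : R), precompact (ball x r)
}.

Definition diam : \bar R :=
  ereal_sup [set (mdist xy.1 xy.2)%:E | xy in [set: M * M]].

Record scale_function (w : M -> R -> R) : Prop := {
  scale_ge0 : forall x r, 0 <= r -> 0 <= w x r ;
  scale_continuous : forall x, {within `[0, +oo[, continuous (w x)} ;
  scale_increasing : forall x r s, 0 <= r -> r < s -> w x r < w x s ;
  scale_0 : forall x, w x 0 = 0 ;
  scale_regular : exists C1 C2 beta1 beta2 : R,
    [/\ 0 < C1, 0 < C2, 0 < beta1, beta1 <= beta2 &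
      forall (r rho : R) (x y : M), 0 < r -> r <= rho -> mdist x y <= rho ->
        C1 * (rho / r) `^ beta1 <= w x rho / w y r /\
        w x rho / w y r <= C2 * (rho / r) `^ beta2]
}.

Definition volume_doubling : Prop :=
  exists2 Cmu : R, 1 <= Cmu &
    forall (x : M) (r : R), 0 < r ->
      (mu (ball x (2 * r)) <= Cmu%:E * mu (ball x r))%E.

(* The library's ess_sup and ess_inf are relative to the whole space *)
Definition ess_sup_on (A : set M) (f : M -> \bar R) : \bar R :=
  ereal_inf [set y | {ae mu, forall x, A x -> (f x <= y)%E}].

Definition ess_inf_on (A : set M) (f : M -> \bar R) : \bar R :=
  ereal_sup [set y | {ae mu, forall x, A x -> (y <= f x)%E}].

Definition Linfty_norm_on (A : set M) (f : M -> R) : \bar R :=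
  ess_sup_on A (fun x => `|f x|%:E).

Definition Linfty_on (A : set M) (f : M -> R) : Prop :=
  measurable_fun A f /\ (Linfty_norm_on A f < +oo)%E.

Definition occupation (B A : set M) : R :=
  fine (mu (A `&` B)) / fine (mu B).

(* Elements of L^2 are represented by measurable functions, hence the clauses
   [dom_ae] and [form_ae]. *)
Definition L2norm (u : M -> R) : R := fine ('N[mu]_2%:E [EFin \o u])%E.

Definition energy_norm (E : (M -> R) -> (M -> R) -> R) (u : M -> R) : R :=
  Num.sqrt (E u u + L2norm u ^+ 2).

Record dirichletForm := DirichletForm {
  dom : set (M -> R) ;
  form :> (M -> R) -> (M -> R) -> R ;
  dom_L2 : forall u, dom u -> u \in Lfun mu 2%:E ;
  dom_ae : forall u v, dom u -> measurable_fun [set: M] v ->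
    {ae mu, forall x, u x = v x} -> dom v ;
  form_ae : forall u v z, dom u -> dom v -> dom z ->
    {ae mu, forall x, u x = v x} -> form u z = form v z ;
  dom_0 : dom (cst 0) ;
  dom_lin : forall (a : R) u v, dom u -> dom v ->
    dom (fun x => a * u x + v x) ;
  dom_dense : forall (f : M -> R) (e : R), f \in Lfun mu 2%:E -> 0 < e ->
    exists2 u, dom u & L2norm (f \- u) < e ;
  form_lin : forall (a : R) u v z, dom u -> dom v -> dom z ->
    form (fun x => a * u x + v x) z = a * form u z + form v z ;
  form_sym : forall u v, dom u -> dom v -> form u v = form v u ;
  form_ge0 : forall u, dom u -> 0 <= form u u ;
  form_closed : forall u_ : nat -> M -> R, (forall n, dom (u_ n)) ->
    (forall e : R, 0 < e -> exists N, forall m n : nat, (N <= m)%N ->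
       (N <= n)%N -> energy_norm form (u_ m \- u_ n) < e) ->
    exists2 u, dom u & energy_norm form (u_ n \- u) @[n --> \oo] --> (0 : R) ;
  form_markov : forall u, dom u ->
    dom (fun x => Num.min (Num.max (u x) 0) 1) /\
    form (fun x => Num.min (Num.max (u x) 0) 1)
         (fun x => Num.min (Num.max (u x) 0) 1) <= form u u
}.

Definition C0 (O : set M) (phi : M -> R) : Prop :=
  [/\ continuous phi, compact (closure [set x | phi x != 0]) &
      closure [set x | phi x != 0] `<=` O].

Section dirichlet.
Variable E : dirichletForm.

(* dom' is F + constants and form' the extension of the form to it; the choice
   of the F-part made by dom'_part is immaterial, see form'E. *)
Definition dom' (u : M -> R) : Prop :=
  exists2 v, dom E v & exists a : R, u = (fun x => v x + a).

Definition dom'_part (u : M -> R) : M -> R :=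
  xget (cst 0) [set v | dom E v /\ exists a : R, u = (fun x => v x + a)].

Definition form' (u v : M -> R) : R := E (dom'_part u) (dom'_part v).

Definition form'_well_defined : Prop :=
  forall u1 u2 v1 v2 (a1 a2 b1 b2 : R),
    dom E u1 -> dom E u2 -> dom E v1 -> dom E v2 ->
    (fun x => u1 x + a1) = (fun x => u2 x + a2) ->
    (fun x => v1 x + b1) = (fun x => v2 x + b2) ->
    E u1 v1 = E u2 v2.

Lemma form'E (u v : M -> R) (a b : R) : form'_well_defined ->
  dom E u -> dom E v ->
  form' (fun x => u x + a) (fun x => v x + b) = E u v.
Proof.
move=> wd Eu Ev; rewrite /form' /dom'_part.
case: xgetP => [u' _ [Eu' [a' uE]]|/(_ u)]; last by case; split=> //; exists a.
case: xgetP => [v' _ [Ev' [b' vE]]|/(_ v)]; last by case; split=> //; exists b.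
by apply: (wd _ _ _ _ a' a b' b).
Qed.

Definition dom_on (O : set M) (phi : M -> R) : Prop :=
  dom E phi /\ forall e : R, 0 < e ->
    exists2 psi, dom E psi /\ C0 O psi & energy_norm E (phi \- psi) < e.

Definition superharmonic (O : set M) (f u : M -> R) : Prop :=
  dom' u /\
  forall phi, dom_on O phi -> {ae mu, forall x, 0 <= phi x} ->
    \int[mu]_(x in O) (f x * phi x) <= form' u phi.

(* The measure J(x, dy) mu(dx) is symmetric, Radon off the diagonal, and is the
   jump measure of E with the normalisation
     \iint (u x - u y) (v x - v y) J(x, dy) mu(dx)
   of the jump part; for disjointly supported u and v only the cross terms
   - 2 \iint u x v y J(x, dy) mu(dx) are left. *)
Record jump_kernel (J : R.-ker M ~> M) : Prop := {
  jump_sym : forall A B : set M, measurable A -> measurable B ->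
    (\int[mu]_(x in A) J x B = \int[mu]_(x in B) J x A)%E ;
  jump_radon : forall A B : set M, compact A -> compact B -> A `&` B = set0 ->
    (\int[mu]_(x in A) J x B < +oo)%E ;
  jump_form : forall u v, dom E u -> dom E v -> C0 setT u -> C0 setT v ->
    closure [set x | u x != 0] `&` closure [set x | v x != 0] = set0 ->
    (E u v)%:E =
      (- (2%:E * \int[mu]_x ((u x)%:E * \int[J x]_y (v y)%:E)))%E
}.

Definition tail (J : R.-ker M ~> M) (U O : set M) (v : M -> R) : \bar R :=
  ess_sup_on U (fun x => \int[J x]_(y in ~` O) `|v y|%:E)%E.

Section harnack.
Variables (J : R.-ker M ~> M) (w : M -> R -> R) (Rbar : \bar R).

Definition neg_part (u : M -> R) : M -> R := fun x => Num.max 0 (- u x).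

(* The quantity multiplied by w(B_r) in the Harnack inequalities *)
Definition TT (x0 : M) (rho : R) (f u : M -> R) : \bar R :=
  (tail J (ball x0 (3 / 4 * rho)) (ball x0 rho) (neg_part u)
   + Linfty_norm_on (ball x0 rho) f)%E.

Definition admissible (x0 : M) (rho : R) (f u : M -> R) : Prop :=
  [/\ Linfty_on (ball x0 rho) f,
      dom' u, u \in Lfun mu +oo%E,
      {ae mu, forall x, ball x0 rho x -> 0 <= u x} &
      superharmonic (ball x0 rho) f u].

Definition wEH : Prop :=
  exists p delta sigma CH : R,
    [/\ 0 < p < 1, 0 < delta < 1, 0 < sigma < 1 & 1 <= CH] /\
    forall (x0 : M) (r rho : R), 0 < r -> r <= delta * rho ->
      (rho%:E < sigma%:E * Rbar)%E ->
    forall f u : M -> R, admissible x0 rho f u ->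
      ((((fine (mu (ball x0 r)))^-1 *
         \int[mu]_(x in ball x0 r) (u x `^ p)) `^ p^-1)%:E
       <= CH%:E * (ess_inf_on (ball x0 r) (EFin \o u)
                   + (w x0 r)%:E * TT x0 rho f u))%E.

Definition wEH1 : Prop :=
  exists (sigma delta1 : R) (eps1 : R -> R),
    [/\ 0 < sigma < 1, 0 < delta1 < 4^-1 &
        forall eta, 0 < eta <= 1 -> 0 < eps1 eta < 1] /\
    forall (x0 : M) (rho r : R), 0 < rho -> (rho%:E < sigma%:E * Rbar)%E ->
      0 < r -> r < delta1 * rho ->
    forall (f : M -> R) (eta1 : R) (u : M -> R) (a : R),
      0 < eta1 <= 1 -> admissible x0 rho f u -> 0 < a ->
      eta1 <= occupation (ball x0 r) [set x | a <= u x] ->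
      ((eps1 eta1 * a)%:E - (w x0 r)%:E * TT x0 rho f u
       < ess_inf_on (ball x0 (4 * r)) (EFin \o u))%E.

Definition wEH2 : Prop :=
  exists sigma delta2 C : R,
    [/\ 0 < sigma < 1, 0 < delta2 < 1 & 0 < C] /\
    forall (x0 : M) (rho r : R), 0 < rho -> (rho%:E < sigma%:E * Rbar)%E ->
      0 < r -> r < delta2 * rho ->
    forall (a : R) (f u : M -> R), 0 < a -> admissible x0 rho f u ->
      let om := occupation (ball x0 r) [set x | a <= u x] in
      ((a * (if om == 0 then 0 else expR (- (C / om))))%:E
         - (w x0 r)%:E * TT x0 rho f u
       <= ess_inf_on (ball x0 r) (EFin \o u))%E.

Definition wEH3 : Prop :=
  exists (sigma delta3 : R) (F : R -> R),
    [/\ 0 < sigma < 1, 0 < delta3 < 1 &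
        forall eta, 0 < eta <= 1 -> 0 < F eta <= 1] /\
    forall (x0 : M) (rho r : R), 0 < rho -> (rho%:E < sigma%:E * Rbar)%E ->
      0 < r -> r <= delta3 * rho ->
    forall (eta3 : R) (f u : M -> R) (a : R),
      0 < eta3 <= 1 -> admissible x0 rho f u -> 0 < a ->
      eta3 <= occupation (ball x0 r) [set x | a <= u x] ->
      ((w x0 r)%:E * TT x0 rho f u <= (F eta3 * a)%:E)%E ->
      ((F eta3 * a)%:E <= ess_inf_on (ball x0 r) (EFin \o u))%E.

Definition wEH4 : Prop :=
  exists sigma eps4 delta4 : R,
    [/\ 0 < sigma < 1, 0 < eps4 < 1 & 0 < delta4 < 1] /\
    forall (x0 : M) (rho : R), 0 < rho -> (rho%:E < sigma%:E * Rbar)%E ->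
    forall (f u : M -> R) (a : R), admissible x0 rho f u -> 0 < a ->
      2^-1 <= occupation (ball x0 (delta4 * rho)) [set x | a <= u x] ->
      ((w x0 (delta4 * rho))%:E * TT x0 rho f u <= (eps4 * a)%:E)%E ->
      ((eps4 * a)%:E
       <= ess_inf_on (ball x0 (2^-1 * (delta4 * rho))) (EFin \o u))%E.

End harnack.
End dirichlet.
End metric_measure.

Arguments diam {R d} M.

(* Main.v *)
Require Import Defs.
From mathcomp Require Import all_boot all_order all_algebra.
From mathcomp Require Import all_classical all_reals all_analysis.
From mathcomp Require Import measurable_realfun ess_sup_inf zify ring lra.

Set Implicit Arguments.
Unset Strict Implicit.
Unset Printing Implicit Defensive.

Import Order.TTheory GRing.Theory Num.Theory.
Import numFieldNormedType.Exports.

Local Open Scope classical_set_scope.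
Local Open Scope ring_scope.

(** In each of the four conditions the tail term only matters up to a constant
    factor: the essential infimum is nonnegative, so a bound
    [ess inf >= c a - K w T] with [K >= 1] gives [ess inf >= (c / K) a - w T],
    and a lower bound that is negative holds trivially.  Hence, once
    densities at comparable scales are compared by doubling, the implications
    wEH -> wEH2 -> wEH3 -> wEH1 and wEH3 -> wEH4 are elementary.  The
    first one is Markov's inequality, which yields a bound that depends
    polynomially on the density of [{u >= a}], much better than exponentially.

    The substance is wEH1 -> wEH ([wEH1_wEH]), an argument of Krylov and
    Safonov.  Let [C >= 2] be a doubling constant and [kappa] half of the factor
    that wEH1 provides for the density [C^-7].  For a set [G] on which [u >= b],
    wEH1 says that [u >= kappa b] on every ball in which [G] has density at
    least [C^-7], as long as [kappa b] exceeds a threshold proportional to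
    [w T].  The union
    [U] of the balls in which [G] has density at least [C^-4] is larger than
    [G] by the factor [C ^ 2] ([le_dense_cover]): a Vitali selection among the
    dense balls whose concentric enlargement is no longer dense bounds [mu G] by
    [C^-2 mu U], and almost all of [G] lies in [U].  Iterating, a set of
    relative measure [C ^ -(2 N + 6)] grows to a fixed proportion of the ball
    in at most [N] steps, each of which costs a factor [kappa] in the lower
    bound ([growing_sets]).  So [{u >= kappa ^ -(N + 1) L}] has
    relative measure at most [C ^ -(2 N)] as soon as [L] exceeds
    [ess inf u + K w T], and summing over the level sets bounds the mean of
    [u ^ p] by a multiple of [L ^ p] when [kappa ^ -p <= C]
    ([integral_powR_decay]).

    Balls of a general metric space can meet [B_r] in sets of tiny measure,
    so [U] is not cut off at [B_r].  Instead the sets are allowed to grow out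
    of [B_r]: the radius of a dense ball is controlled by [mu G], so that the
    radii of successive steps form a geometric series and all the sets stay in
    [B_(2 r)].

    To use wEH1 in balls with other centres than that of [B_R], [u] has to be
    admissible in smaller balls contained in [B_R], with no larger tail term
    ([admissibleS], [TT_sub]).  This holds because a null set of [mu] is
    null for [J (x, .)] for almost every [x], by symmetry of the jump measure,
    and because the test functions of a ball vanish outside it. *)

(** * Balls of a metric measure space *)

Section balls.
Context {R : realType} {d : measure_display} {M : metricMeasurableType R d}.
Implicit Types (x y z : M) (r s : R).

Lemma in_ball x r y : ball x r y <-> mdist x y < r.
Proof. by rewrite ballEmdist. Qed.

Lemma sub_ball x r y s : mdist x y + r <= s -> ball x r `<=` ball y s.
Proof.
move=> h z /in_ball xz; apply/in_ball.
apply: le_lt_trans (metric_triangle _ x _) _.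
by rewrite metric_sym; lra.
Qed.

Lemma open_ball x r : open (ball x r).
Proof.
rewrite openE => y /in_ball xy; apply/nbhs_ballP; exists (r - mdist x y) => /=.
  by rewrite subr_gt0.
by apply: sub_ball; rewrite metric_sym; lra.
Qed.

End balls.

Section measure_of_balls.
Context {R : realType} {d : measure_display} {M : metricMeasurableType R d}.
Variable mu : {measure set M -> \bar R}.
Hypothesis mms : metric_measure_space mu.
Implicit Types (x y z : M) (r s : R).

Lemma open_borel (U : set M) : open U -> measurable U.
Proof. by move=> oU; rewrite (mms_borel mms); exact: sub_sigma_algebra. Qed.

Lemma ball_borel x r : measurable (ball x r : set M).
Proof. exact/open_borel/open_ball. Qed.

Hint Resolve ball_borel : core.

Lemma ball_fin x r : (mu (ball x r) < +oo)%E.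
Proof.
have := mms_precompact_ball mms x r; rewrite precompactE.
move=> /(radon_compact (mms_radon mms)); apply: le_lt_trans.
apply: le_measure; rewrite ?inE//; last exact: subset_closure.
rewrite -[X in measurable X]setCK; apply: measurableC.
by apply/open_borel/closed_openC/closed_closure.
Qed.

Lemma ball_gt0 x r : 0 < r -> (0 < mu (ball x r))%E.
Proof.
move=> r0; apply: (mms_full_support mms); first exact: open_ball.
by exists x; exact: ballxx.
Qed.

Lemma ball_fin_num x r : mu (ball x r) \is a fin_num.
Proof. by rewrite ge0_fin_numE ?measure_ge0// ball_fin. Qed.

End measure_of_balls.

(** * Covering by balls *)

Section covering.
Context {R : realType} {d : measure_display} {M : metricMeasurableType R d}.
Variable mu : {measure set M -> \bar R}.
Hypothesis mms : metric_measure_space mu.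
Variables (I : countType) (q : I -> M) (s : I -> R) (A : set M) (c : R).
Hypotheses (mA : measurable A) (c0 : 0 <= c).

Let B i := ball (q i) (s i).
Let cover (l : seq I) := \bigcup_(i in [set` l]) B i.

Let mcover l : measurable (cover l).
Proof.
by rewrite /cover bigcup_seq; apply: bigsetU_measurable => i _; exact: (ball_borel mms).
Qed.

(** The greedy selection of Vitali's covering lemma: a largest ball is charged
    for every ball that meets it, since they all lie in its dilation by 3, and
    the remaining balls are disjoint from it. *)
Lemma finite_covering (l : seq I) :
  (forall i, i \in l ->
     (mu (A `&` ball (q i) (3 * s i)) <= c%:E * mu (B i))%E) ->
  (mu (A `&` cover l) <= c%:E * mu (cover l))%E.
Proof.
have [n] := ubnP (size l); elim: n l => // n IH [|i0 l0] ln small.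
  by rewrite /cover bigcup_seq big_nil setI0 measure0 mule0.
set l := i0 :: l0 in ln small *.
have [j jl jmax] : exists2 j, j \in l & forall i, i \in l -> s i <= s j.
  exists (nth i0 l [arg max_(k > (ord0 : 'I_(size l))) s (nth i0 l k)]%O).
    by rewrite mem_nth.
  case: Order.TotalTheory.arg_maxP => // k _ kmax i il.
  have il' : (index i l < size l)%N by rewrite index_mem.
  by have := kmax (Ordinal il') isT; rewrite /= nth_index.
pose l' := [seq i <- l | `[< B i `&` B j = set0 >]].
have sl' : {subset l' <= l} by move=> i; rewrite mem_filter => /andP[].
have disj : B j `&` cover l' = set0.
  rewrite -subset0 => x [jx [i /=]]; rewrite mem_filter => /andP[/asboolP ij _] ix.
  by have : (B i `&` B j) x by []; rewrite ij.
have bj0 : (0 < s j -> (size l' < size l)%N).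
  move=> sj; rewrite size_filter -(count_predC (fun i => `[< B i `&` B j = set0 >]) l).
  rewrite -[X in (X < _)%N]addn0 ltn_add2l -has_count; apply/hasP; exists j => //=.
  apply/asboolPn; rewrite setIid => bj0.
  by have := @ballxx _ _ (q j) _ sj; rewrite -/(B j) bj0.
have [sj|sj] := ltP 0 (s j); last first.
  (* radii may be nonpositive; then no ball of the family has a point *)
  have -> : cover l = set0.
    rewrite -subset0 => x [i il /in_ball ix]; have := le_trans (jmax _ il) sj.
    by rewrite leNgt => /negP; apply; apply: le_lt_trans ix; exact: mdist_ge0.
  by rewrite setI0 measure0 mule0.
have sub1 : A `&` cover l `<=`
    (A `&` ball (q j) (3 * s j)) `|` (A `&` cover l').
  move=> x [Ax [i il ix]].
  have [ij|/set0P[z [/in_ball iz /in_ball jz]]] := eqVneq (B i `&` B j) set0.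
    by right; split=> //; exists i => //=; rewrite mem_filter il andbT; exact/asboolP.
  left; split=> //; apply/in_ball; move/in_ball : ix => ix.
  have := jmax _ il; have := metric_triangle (q j) z x.
  have := metric_triangle z (q i) x; rewrite [mdist z (q i)]metric_sym; lra.
have sub2 : B j `|` cover l' `<=` cover l.
  move=> x [jx|[i /sl' il ix]]; [by exists j|by exists i].
have mB i r : measurable (ball (q i) r : set M) by exact: ball_borel mms _ _.
apply: (@le_trans _ _ (mu (A `&` ball (q j) (3 * s j)) + mu (A `&` cover l')))%E.
  apply: le_trans (measureU2 _ _ _); last 2 first.
  - exact: measurableI.
  - exact: measurableI.
  by apply: le_measure; rewrite ?inE//;
    [exact: measurableI|apply: measurableU; exact: measurableI].
apply: (@le_trans _ _ (c%:E * mu (B j) + c%:E * mu (cover l')))%E.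
  apply: leeD; first exact: small.
  apply: IH; first exact: (leq_trans (bj0 sj)).
  by move=> i /sl'; exact: small.
rewrite -ge0_muleDr ?measure_ge0// -measureU//; last exact: mB.
apply: lee_wpmul2l; first by rewrite lee_fin.
apply: le_measure; rewrite ?inE//.
by apply: measurableU => //; exact: mB.
Qed.

Lemma countable_covering (P : set I) :
  (forall i, P i -> (mu (A `&` ball (q i) (3 * s i)) <= c%:E * mu (B i))%E) ->
  (mu (A `&` \bigcup_(i in P) B i) <= c%:E * mu (\bigcup_(i in P) B i))%E.
Proof.
move=> small.
have [l lP] : exists l : nat -> seq I,
    forall n i, (i \in l n) <-> P i /\ (pickle i < n)%N.
  exists (fun n => [seq i <- pmap unpickle (iota 0 n) | `[< P i >] & (pickle i < n)%N]).
  move=> n i; rewrite mem_filter; split=> [/andP[/andP[/asboolP ? ->]]//|[Pi ni]].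
  rewrite ni (asboolT Pi) mem_pmap; apply/mapP; exists (pickle i).
    by rewrite mem_iota.
  by rewrite pickleK.
have coverE : \bigcup_(i in P) B i = \bigcup_n cover (l n).
  apply/seteqP; split=> [x [i Pi ix]|x [n _ [i /lP[Pi _] ix]]]; last by exists i.
  by exists (pickle i).+1 => //; exists i => //=; apply/lP.
have mU : measurable (\bigcup_n cover (l n)) by exact: bigcup_measurable.
rewrite coverE setI_bigcupr.
have cvgA : mu (A `&` cover (l n)) @[n --> \oo] -->
    mu (\bigcup_n (A `&` cover (l n))).
  apply: nondecreasing_cvg_mu => [n||n m nm].
  - exact: measurableI.
  - by rewrite -setI_bigcupr; exact: measurableI.
  - apply/subsetPset; apply: setIS => x [i /lP[Pi ni] ix].
    by exists i => //; apply/lP; split=> //; exact: leq_trans nm.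
rewrite -(cvg_lim _ cvgA)//; apply: lime_le; first by apply/cvg_ex; eexists; exact: cvgA.
apply: nearW => n.
apply: le_trans (finite_covering _) _.
  by move=> i /lP[Pi _]; exact: small.
apply: lee_wpmul2l; first by rewrite lee_fin.
by apply: le_measure; rewrite ?inE// => x nx; exists n.
Qed.

End covering.

(** * Growth of sets in a doubling space *)

Lemma dense_sequence {R : realType} {d : measure_display}
    {M : metricMeasurableType R d} (mu : {measure set M -> \bar R}) (x0 : M) :
  metric_measure_space mu ->
  exists q : nat -> M, forall x (e : R), 0 < e -> exists n, mdist (q n) x < e.
Proof.
move=> mms; have [D cD dD] := mms_separable mms.
have meet x (e : R) : 0 < e -> exists2 y, D y & mdist y x < e.
  move=> e0; have [||y [/in_ball xy Dy]] := dD (ball x e) _ _.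
  - by exists x; exact: ballxx.
  - exact: open_ball.
  by exists y => //; rewrite metric_sym.
have /pfcard_geP[D0|[q]] := cD.
  by have [y] := meet x0 1 ltr01; rewrite D0.
exists q => x e /(meet x)[y Dy yx]; have [n _ qn] := 'surj_q Dy.
by exists n; rewrite qn.
Qed.

Section growth.
Context {R : realType} {d : measure_display} {M : metricMeasurableType R d}.
Variable mu : {measure set M -> \bar R}.
Hypothesis mms : metric_measure_space mu.
Variable C : R.
Hypothesis C2 : 2 <= C.
Hypothesis doubling : forall (x : M) (r : R), 0 < r ->
  (mu (ball x (2 * r)) <= C%:E * mu (ball x r))%E.
Implicit Types (x y z : M) (r s : R).

Let C0 : 0 < C. Proof. by move: C2; lra. Qed.
Let mb x r : measurable (ball x r : set M). Proof. exact: ball_borel mms _ _. Qed.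

Lemma doubling_iter n x r : 0 < r ->
  (mu (ball x (2 ^+ n * r)) <= (C ^+ n)%:E * mu (ball x r))%E.
Proof.
move=> r0; elim: n => [|n IH]; first by rewrite !expr0 mul1r mul1e.
rewrite exprS -mulrA; apply: le_trans (doubling _ _) _.
  by rewrite mulr_gt0// exprn_gt0.
by rewrite exprS EFinM -muleA; apply: lee_wpmul2l => //; rewrite lee_fin ltW.
Qed.

Lemma doubling_sub n x r y s : 0 < s -> mdist x y + r <= 2 ^+ n * s ->
  (mu (ball x r) <= (C ^+ n)%:E * mu (ball y s))%E.
Proof.
move=> s0 h; apply: le_trans (doubling_iter n _ s0).
by apply: le_measure; rewrite ?inE//; exact: sub_ball.
Qed.

Section density.
Variables (E : set M) (q : nat -> M) (r eta : R).
Hypotheses (mE : measurable E) (finE : (mu E < +oo)%E) (r0 : 0 < r).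
Hypothesis q_dense : forall x (e : R), 0 < e -> exists n, mdist (q n) x < e.
Hypotheses (eta0 : 0 < eta) (etaC : eta * C ^+ 2 < 1).

(** The centres run over a countable dense set, which keeps unions of such
    balls measurable; the ratio 4 of consecutive radii makes the dilation by 3
    of a ball, needed for the covering, fit in its parent. *)
Definition grid_ball (i : nat * nat) : set M := ball (q i.1) (r / 4 ^+ i.2).

Definition dense_ball (i : nat * nat) : Prop :=
  (eta%:E * mu (grid_ball i) <= mu (E `&` grid_ball i))%E.

Definition dense_cover : set M := \bigcup_(i in dense_ball) grid_ball i.

Let rk k : 0 < r / 4 ^+ k. Proof. by rewrite divr_gt0// exprn_gt0. Qed.

Let rkS k : r / 4 ^+ k = 4 * (r / 4 ^+ k.+1).
Proof. by rewrite exprS; field; rewrite expf_neq0. Qed.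

Lemma measurable_dense_cover : measurable dense_cover.
Proof.
rewrite /dense_cover bigcup_mkcond.
apply: countable_bigcupT_measurable => // i.
by case: ifP => // _; exact: mb.
Qed.

Let subS n k : grid_ball (n, k.+1) `<=` grid_ball (n, k).
Proof. by apply: sub_ball; rewrite mdistxx add0r [leRHS]rkS/=; have := rk k.+1; lra. Qed.

(** A ball whose parent is sparse is a legitimate charge for its dilation. *)
Let sparse_parent n k : ~ dense_ball (n, k) ->
  (mu (E `&` ball (q n) (3 * (r / 4 ^+ k.+1)))
   <= (eta * C ^+ 2)%:E * mu (grid_ball (n, k.+1)))%E.
Proof.
move=> /negP; rewrite -ltNge => /ltW sparse.
apply: (@le_trans _ _ (mu (E `&` grid_ball (n, k)))).
  apply: le_measure; rewrite ?inE//; try by apply: measurableI => //; exact: mb.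
  apply: setIS; apply: sub_ball; rewrite mdistxx add0r [leRHS]rkS/=.
  by have := rk k.+1; lra.
apply: (le_trans sparse); rewrite EFinM -muleA; apply: lee_wpmul2l.
  by rewrite lee_fin ltW.
by apply: doubling_sub; rewrite ?mdistxx ?add0r//= [leLHS]rkS expr2; lra.
Qed.

(** Almost every point of [E] lies in a dense ball: otherwise the exceptional
    part has density at most [eta * C ^+ 2 < 1] in every open set around it. *)
Lemma dense_cover_ae : mu (E `\` dense_cover) = 0.
Proof.
set A := E `\` dense_cover.
have mA : measurable A by apply: measurableD => //; exact: measurable_dense_cover.
have fA : mu A \is a fin_num.
  rewrite ge0_fin_numE ?measure_ge0//; apply: le_lt_trans finE.
  by apply: le_measure; rewrite ?inE// => x [].
set c := eta * C ^+ 2; have c1 : c < 1 by [].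
have c0 : 0 < c by rewrite mulr_gt0// exprn_gt0.
have Aopen (O : set M) : open O -> A `<=` O -> (mu A <= c%:E * mu O)%E.
  move=> oO AO.
  pose P (i : nat * nat) :=
    [/\ (0 < i.2)%N, grid_ball i `<=` O & grid_ball i `&` A !=set0].
  have AP : A `<=` \bigcup_(i in P) grid_ball i.
    move=> x Ax; have := oO; rewrite openE => /(_ x (AO _ Ax)).
    move=> /nbhs_ballP[e /= e0 xO].
    have [k kle] : exists k, 2 * (r / 4 ^+ k.+1) < e.
      have [k kP] : exists k, 2 * r / e < k%:R.
        by exists (Num.bound (2 * r / e)); rewrite archi_boundP// ltW// divr_gt0// mulr_gt0.
      exists k; rewrite mulrA ltr_pdivrMr ?exprn_gt0//.
      move: kP; rewrite ltr_pdivrMr// => kP.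
      apply: (lt_le_trans kP); rewrite mulrC ler_pM2l//.
      rewrite -natrX ler_nat ltnW// (leq_trans (ltnSn k))//.
      exact/ltnW/ltn_expl.
    have [n nx] := q_dense x (rk k.+1).
    exists (n, k.+1); last exact/in_ball.
    split=> //; last by exists x; split=> //; exact/in_ball.
    apply: subset_trans xO; apply: sub_ball => /=; lra.
  rewrite -{1}(setIidl AP).
  apply: le_trans (countable_covering mms mA (ltW c0) _) _.
    case=> [n [|k]] []//= _ _ [x [xk Ax]].
    apply: le_trans (sparse_parent (_ : ~ dense_ball (n, k))).
      apply: le_measure; rewrite ?inE//; try by apply: measurableI => //; exact: mb.
      by apply: setSI => y [].
    move=> nk; have [_] := Ax; apply; exists (n, k) => //; exact: subS xk.
  apply: lee_wpmul2l; first by rewrite lee_fin ltW.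
  apply: le_measure; rewrite ?inE.
  - rewrite bigcup_mkcond; apply: countable_bigcupT_measurable => // i.
    by case: ifP => // _; exact: mb.
  - exact: (open_borel mms oO).
  - by move=> x [i [_ iO _] /iO].
apply/eqP; rewrite eq_le measure_ge0 andbT leNgt; apply/negP => A0.
have : (mu A < (c^-1)%:E * mu A)%E.
  have a0 : 0 < fine (mu A) by rewrite fine_gt0// A0 -ge0_fin_numE.
  by rewrite -(fineK fA) -EFinM lte_fin ltr_pMl// invf_gt1.
rewrite [X in (X < _)%E -> _](radon_outer (mms_radon mms))//.
move=> /ereal_inf_ltP[_ [V [oV AV] <-] +].
rewrite ltNge => /negP; apply.
have := Aopen _ oV AV; rewrite -lee_pdivrMl//.
Qed.

(** Following parents from a dense ball ends at a dense ball with a sparse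
    parent, as the largest balls are sparse.  The balls with a sparse parent
    thus cover as much as all dense ones, and they can be charged. *)
Lemma le_dense_cover : (forall n, ~ dense_ball (n, 0%N)) ->
  (mu E <= (eta * C ^+ 2)%:E * mu dense_cover)%E.
Proof.
move=> sparse0.
pose P (i : nat * nat) := dense_ball i /\ (0 < i.2)%N /\ ~ dense_ball (i.1, i.2.-1).
have coverP : dense_cover = \bigcup_(i in P) grid_ball i.
  apply/seteqP; split=> [x [[n k]]|x [i [di _] ix]]; last by exists i.
  elim: k => [/sparse0//|k IH dk kx].
  have [dk'|dk'] := pselect (dense_ball (n, k)); first exact: (IH dk' (subS kx)).
  by exists (n, k.+1).
have mU := measurable_dense_cover.
rewrite (measureDI mu mE mU) [X in (X + _)%E]dense_cover_ae add0e.
rewrite coverP; apply: (countable_covering mms mE).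
  by rewrite mulr_ge0 ?exprn_ge0// ltW.
by case=> [n [|k]] [_ []]//= _; exact: sparse_parent.
Qed.

End density.
End growth.

(** * Essential bounds on a set *)

Section essential_bounds.
Context {R : realType} {d : measure_display} {M : metricMeasurableType R d}.
Variable mu : {measure set M -> \bar R}.
Implicit Types (A B : set M) (f g : M -> \bar R) (y : \bar R).
Local Open Scope ereal_scope.

Lemma ess_inf_on_ge A f y :
  {ae mu, forall x, A x -> y <= f x} -> y <= ess_inf_on mu A f.
Proof. by move=> h; exact: ereal_sup_ubound. Qed.

Lemma ess_inf_on_gt A f y :
  y < ess_inf_on mu A f -> {ae mu, forall x, A x -> y <= f x}.
Proof.
move=> /ereal_sup_gtP[z zf yz]; apply: filterS zf => x + Ax.
by move=> /(_ Ax); apply: le_trans; exact: ltW.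
Qed.

Lemma ess_inf_onS A B f : A `<=` B -> ess_inf_on mu B f <= ess_inf_on mu A f.
Proof.
by move=> AB; apply: le_ereal_sup => y; apply: filterS => x + /AB; apply.
Qed.

Lemma le_ess_sup_on A B f g : A `<=` B ->
  {ae mu, forall x, A x -> f x <= g x} -> ess_sup_on mu A f <= ess_sup_on mu B g.
Proof.
move=> AB fg; apply: le_ereal_inf => y; apply: filterS2 fg => x fg gy Ax.
exact: le_trans (fg Ax) (gy (AB _ Ax)).
Qed.

Lemma ae_meets A (P : M -> Prop) : measurable A -> 0 < mu A ->
  {ae mu, forall x, A x -> P x} -> exists2 x, A x & P x.
Proof.
move=> mA A0 [N [mN N0 PN]]; apply: contrapT => h.
have AN : A `<=` N.
  by move=> x Ax; apply: PN => /= /(_ Ax) Px; apply: h; exists x.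
have : mu A <= mu N by apply: le_measure; rewrite ?inE.
by rewrite N0 leNgt A0.
Qed.

Lemma ess_sup_on_ge0 A f : measurable A -> 0 < mu A ->
  (forall x, 0 <= f x) -> 0 <= ess_sup_on mu A f.
Proof.
move=> mA A0 f0; apply: le_ereal_inf_tmp => y /(ae_meets mA A0)[x _].
exact: le_trans.
Qed.

Lemma ess_inf_on_le A (u : M -> R) (K : R) : measurable A -> 0 < mu A ->
  {ae mu, forall x, (u x <= K)%R} -> ess_inf_on mu A (EFin \o u) <= K%:E.
Proof.
move=> mA A0 uK; apply: ge_ereal_sup => y yu.
have h : {ae mu, forall x, A x -> y <= K%:E}.
  apply: filterS2 yu uK => x yu uK Ax.
  by apply: le_trans (yu Ax) _; rewrite lee_fin.
by have [] := ae_meets mA A0 h.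
Qed.

Lemma Lfun_infty_bounded (u : M -> R) : u \in Lfun mu +oo ->
  exists2 K : R, (0 <= K)%R & {ae mu, forall x, (`|u x| <= K)%R}.
Proof.
move=> /sub_Lfun_finLfun; rewrite inE /finite_norm/= unlock /=.
case: ifPn => [_ fin|mu0 _]; last first.
  exists 0%R => //; exists setT; split=> //.
  by apply/eqP; rewrite eq_le measure_ge0 andbT leNgt.
have : {ae mu, forall x, `|(u x)%:E| <= ess_sup mu (abse \o EFin \o u)}.
  exact: ess_sup_ge.
have [K Kge] : exists K : R, ess_sup mu (abse \o EFin \o u) <= K%:E.
  case: (ess_sup _ _) fin => [r| |]//; first by exists r.
  by exists 0%R; rewrite leNye.
move=> h; exists (Num.max K 0)%R; first by rewrite le_max lexx orbT.
apply: filterS h => x h; rewrite le_max; apply/orP; left.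
by rewrite -lee_fin; apply: le_trans Kge.
Qed.

End essential_bounds.

(** * Restriction to smaller balls *)

Section restriction.
Context {R : realType} {d : measure_display} {M : metricMeasurableType R d}.
Variable mu : {measure set M -> \bar R}.
Hypothesis mms : metric_measure_space mu.
Variable E : dirichletForm mu.
Variable J : R.-ker M ~> M.
Hypothesis hJ : jump_kernel E J.
Implicit Types (O : set M) (phi u f : M -> R).

(** By symmetry the jump measure of [M * N] is that of [N * M], which is null. *)
Lemma jump_null (N : set M) : measurable N -> mu N = 0%E ->
  {ae mu, forall x, J x N = 0%E}.
Proof.
move=> mN N0; have := jump_sym hJ measurableT mN.
have mJ A : measurable A -> measurable_fun [set: M] (fun x => J x A).
  by move=> mA; exact: measurable_kernel.
rewrite (ge0_negligible_integral mN mN)//; last 1 first.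
  by apply: measurable_funTS; exact: mJ.
rewrite setDv integral_set0 => JN.
have JN0 : (\int[mu]_(x in [set: M]) `|J x N| = 0)%E.
  by rewrite -JN; apply: eq_integral => x _; rewrite gee0_abs.
have := (ae_eq_integral_abs mu measurableT (mJ _ mN)).1 JN0.
by apply: filterS => x; exact.
Qed.

(** The functions of [F] with compact support in [O] vanish outside [O], and
    the energy norm dominates the [L^2] norm. *)
Lemma dom_on_ae0 O phi : measurable O -> dom_on E O phi ->
  {ae mu, forall x, ~ O x -> phi x = 0}.
Proof.
move=> mO [Dphi approx].
have mphi : measurable_fun [set: M] phi.
  by have /sub_Lfun_mfun := dom_L2 Dphi; rewrite inE.
pose F x := (`|(phi x)%:E| `^ 2)%E.
have mF : measurable_fun [set: M] F.
  apply: measurableT_comp (measurable_poweR 2) _.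
  by apply: measurableT_comp => //; exact/measurable_EFinP.
have F0 x : (0 <= F x)%E by exact: poweR_ge0.
have le e : 0 < e -> (\int[mu]_(x in ~` O) F x <= (e `^ 2)%:E)%E.
  move=> e0; have [psi [Dpsi [cpsi _ psiO]] phipsi] := approx _ e0.
  have DB : dom E (phi \- psi).
    have -> : phi \- psi = (fun x => -1 * psi x + phi x).
      by apply/funext => x /=; ring.
    exact: dom_lin.
  have L2 := dom_L2 DB.
  set g := phi \- psi in DB L2 phipsi.
  have mg : measurable_fun [set: M] g by have /sub_Lfun_mfun := L2; rewrite inE.
  have fin : ('N[mu]_2%:E[EFin \o g] < +oo)%E.
    by have /sub_Lfun_finLfun := L2; rewrite inE.
  have ge : ('N[mu]_2%:E[EFin \o g] <= e%:E)%E.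
    rewrite -(@fineK _ 'N[mu]_2%:E[EFin \o g])%E ?ge0_fin_numE ?Lnorm_ge0//.
    rewrite lee_fin; apply: le_trans (ltW phipsi).
    rewrite -/(L2norm mu g) /energy_norm -{1}(@ger0_norm _ (L2norm mu g)); last first.
      by rewrite fine_ge0// Lnorm_ge0.
    by rewrite -sqrtr_sqr ler_wsqrtr// lerDr form_ge0.
  rewrite -poweR_EFin; apply: (@le_trans _ _ ('N[mu]_2%:E[EFin \o g] `^ 2)%E); last first.
    by apply: gt0_ler_poweR => //; rewrite in_itv/= ?Lnorm_ge0 ?lee_fin ?leey// ltW.
  rewrite poweR_Lnorm//.
  have mG : measurable_fun [set: M] (fun x => `|(EFin \o g) x| `^ 2)%E.
    apply: measurableT_comp (measurable_poweR 2) _.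
    by apply: measurableT_comp => //; exact/measurable_EFinP.
  apply: (@le_trans _ _ (\int[mu]_(x in ~` O) (`|(EFin \o g) x| `^ 2))%E); last first.
    apply: ge0_subset_integral => //; first exact: measurableC.
    by move=> x _; exact: poweR_ge0.
  rewrite le_eqVlt; apply/orP; left; apply/eqP; apply: eq_integral => x.
  rewrite inE /= => Ox; rewrite /F /g /=.
  suff -> : psi x = 0 by rewrite subr0.
  apply: contrapT => /eqP psix; apply: Ox; apply: psiO.
  exact: subset_closure.
have mOC : measurable (~` O) by exact: measurableC.
have : (\int[mu]_(x in ~` O) `|F x| = 0)%E.
  under eq_integral do rewrite gee0_abs//.
  apply/eqP; rewrite eq_le integral_ge0// andbT.
  apply/lee_addgt0Pr => e e0; rewrite add0e.
  have := le (Num.sqrt e); rewrite sqrtr_gt0 => /(_ e0).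
  by rewrite powR_mulrn ?sqrtr_ge0// sqr_sqrtr// ltW.
move=> /(ae_eq_integral_abs mu mOC (measurable_funTS mF)); apply: filterS => x /=.
move=> + Ox => /(_ Ox); rewrite /F poweR_EFin => -[] /powR_eq0_eq0.
by move=> /eqP; rewrite normr_eq0 => /eqP.
Qed.

Lemma dom_onS O1 O2 phi : O1 `<=` O2 -> dom_on E O1 phi -> dom_on E O2 phi.
Proof.
move=> O12 [Dphi approx]; split=> // e /approx[psi [Dpsi [? ? psiO]] ?].
by exists psi => //; split=> //; split=> //; exact: subset_trans O12.
Qed.

(** A test function of [O1] is one of [O2], and it vanishes on the part of
    [O2] outside [O1], so that both source terms agree. *)
Lemma superharmonicS O1 O2 f u : measurable O1 -> measurable O2 -> O1 `<=` O2 ->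
  measurable_fun O2 f -> superharmonic E O2 f u -> superharmonic E O1 f u.
Proof.
move=> m1 m2 O12 mf [Du sup]; split=> // phi phi1 phi0.
apply: le_trans (sup phi (dom_onS O12 phi1) phi0).
have mphi : measurable_fun [set: M] phi.
  by have /sub_Lfun_mfun := dom_L2 phi1.1; rewrite inE.
have mfphi : measurable_fun O2 (EFin \o (fun x => f x * phi x)).
  by apply/measurable_EFinP; apply: measurable_funM => //; exact: measurable_funTS.
rewrite -{1}(setIidr O12) Rintegral_mkcondr /Rintegral.
rewrite le_eqVlt; apply/orP; left; apply/eqP; congr fine.
have E1 : (fun x => (((fun y => f y * phi y) \_ O1) x)%:E) =
    ((EFin \o (fun y => f y * phi y)) \_ O1).
  by apply/funext => x; rewrite /patch; case: ifP.
apply: ae_eq_integral => //.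
  rewrite E1; apply/(measurable_restrict _ m1 m2).
  by apply: measurable_funS mfphi => //; exact: subIsetl.
apply: filterS (dom_on_ae0 m1 phi1) => x h O2x.
by rewrite /patch; case: ifPn => //; rewrite notin_setE => /h ->; rewrite mulr0.
Qed.

Section ball_restriction.
Variables (x0 x1 : M) (rho rho' : R) (f u : M -> R).
Hypothesis sub1 : ball x1 rho' `<=` ball x0 rho.
Hypothesis sub2 : ball x1 (3 / 4 * rho') `<=` ball x0 (3 / 4 * rho).
Hypothesis hu : admissible E x0 rho f u.

Let mb x r : measurable (ball x r : set M). Proof. exact: ball_borel mms _ _. Qed.

Let mu_ : measurable_fun [set: M] u.
Proof. by case: hu => _ _ /sub_Lfun_mfun; rewrite inE. Qed.

Lemma admissibleS : admissible E x1 rho' f u.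
Proof.
case: hu => -[mf finf] Du Lu u0 sup; split=> //.
- split; first exact: measurable_funS mf.
  apply: le_lt_trans finf; apply: le_ess_sup_on => //.
  exact: aeW.
- by apply: filterS u0 => x + /sub1.
- by apply: superharmonicS sup.
Qed.

(** Passing to the smaller ball adds to the tail an integral of the negative
    part over a subset of the larger ball, where it vanishes [J (x, .)]-almost
    everywhere for almost every [x]. *)
Lemma TT_sub : (TT mu J x1 rho' f u <= TT mu J x0 rho f u)%E.
Proof.
apply: leeD; last first.
  by apply: le_ess_sup_on => //; exact: aeW.
apply: le_ess_sup_on => //.
case: hu => _ _ _ u0 _.
pose N := ball x0 rho `&` [set x | u x < 0].
have mN : measurable N.
  apply: measurableI => //; rewrite -[X in measurable X]setTI.
  have -> : [set x | u x < 0] = u @^-1` `]-oo, 0[ by apply/seteqP; split=> x /=; rewrite in_itv.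
  exact: mu_.
have N0 : mu N = 0%E.
  apply/negligibleP => //; apply: negligibleS u0 => x [Bx ux] /= /(_ Bx).
  by rewrite leNgt ux.
apply: filterS (jump_null mN N0) => x JN _.
set g := fun y => `|neg_part u y|%:E.
have mg D : measurable_fun D g.
  apply: measurable_funTS; apply/measurable_EFinP; apply: measurableT_comp => //.
  apply: measurable_maxr => //; exact: measurableT_comp.
have -> : ~` ball x1 rho' = ~` ball x0 rho `|` (ball x0 rho `\` ball x1 rho').
  rewrite setDE setUIr setUC setUCr setTI setUidr//.
  exact: subsetC.
rewrite ge0_integral_setU//; last 3 first.
- by apply: measurableC.
- by apply: measurableD.
- by rewrite disj_set2E setDE setIA setICl set0I.
rewrite [X in (_ + X)%E](_ : _ = 0%E) ?adde0//.
rewrite (ge0_negligible_integral mN)//; last exact: measurableD.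
apply: integral0_eq => y [[By _] Ny]; rewrite /g /neg_part max_l ?normr0//.
by rewrite oppr_le0 leNgt; apply/negP => uy; apply: Ny.
Qed.

End ball_restriction.
End restriction.

(** * The elementary implications *)

Section preliminaries.
Context {R : realType} {d : measure_display} {M : metricMeasurableType R d}.
Variable mu : {measure set M -> \bar R}.
Hypothesis mms : metric_measure_space mu.
Implicit Types (x y z : M) (r s : R).

Lemma doubling_const : volume_doubling mu -> exists2 C : R, 2 <= C &
  forall (x : M) (r : R), 0 < r -> (mu (ball x (2 * r)) <= C%:E * mu (ball x r))%E.
Proof.
move=> [C C1 dbl]; exists (C + 1); first by move: C1; lra.
move=> x r r0; apply: (le_trans (dbl x r r0)).
by apply: lee_wpmul2r => //; rewrite lee_fin; lra.
Qed.

Section scale.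
Variable w : M -> R -> R.
Hypothesis hw : scale_function w.

Lemma scale_gt0 x r : 0 < r -> 0 < w x r.
Proof. by move=> r0; rewrite -(scale_0 hw x); exact: scale_increasing. Qed.

Lemma scale_comparable : exists2 K : R, 1 <= K &
  forall x y r s, 0 < s -> s <= 4 * r -> mdist x y <= 4 * r -> w y s <= K * w x r.
Proof.
have [C1 [C2 [b1 [b2 [C10 C20 b10 b12 h]]]]] := scale_regular hw.
exists (Num.max 1 (C2 * 4 `^ b2 / C1)); first by rewrite le_max lexx.
move=> x y r s s0 sr xy.
have r0 : 0 < r by move: s0 sr; lra.
have wx := scale_gt0 x r0; have wy := scale_gt0 y s0.
have [low _] := h s (4 * r) x y s0 sr xy.
have [_ high] : C1 * (4 * r / r) `^ b1 <= w x (4 * r) / w x r /\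
    w x (4 * r) / w x r <= C2 * (4 * r / r) `^ b2.
  by apply: h => //; [lra|rewrite mdistxx; lra].
have {}low : C1 * w y s <= w x (4 * r).
  rewrite -ler_pdivlMr//; apply: le_trans low; apply: ler_peMr; first exact: ltW.
  have q1 : 1 <= 4 * r / s by rewrite ler_pdivlMr// mul1r.
  by have := ler_powR q1 (ltW b10); rewrite powRr0.
have {}high : w x (4 * r) <= C2 * 4 `^ b2 * w x r.
  by move: high; rewrite ler_pdivrMr// mulfK// gt_eqF.
apply: (@le_trans _ _ (C2 * 4 `^ b2 / C1 * w x r)).
  rewrite mulrAC ler_pdivlMr// mulrC; exact: le_trans high.
by rewrite ler_pM2r// le_max lexx orbT.
Qed.

End scale.

Lemma occupation_ge0 (B A : set M) : 0 <= occupation mu B A.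
Proof. by rewrite /occupation divr_ge0// fine_ge0. Qed.

Lemma fine_ball_gt0 x r : 0 < r -> 0 < fine (mu (ball x r)).
Proof. by move=> r0; rewrite fine_gt0// ball_gt0// ball_fin. Qed.

Lemma ball_capE (A : set M) x r : measurable A ->
  mu (A `&` ball x r) = (fine (mu (A `&` ball x r)))%:E.
Proof.
move=> mA; rewrite fineK// ge0_fin_numE//; apply: le_lt_trans (ball_fin mms x r).
have mB := ball_borel mms x r.
by apply: le_measure; rewrite ?inE//; exact: measurableI.
Qed.

Lemma occupation_le1 (A : set M) x r : measurable A -> 0 < r ->
  occupation mu (ball x r) A <= 1.
Proof.
move=> mA r0; rewrite ler_pdivrMr ?fine_ball_gt0// mul1r.
have mB := ball_borel mms x r.
rewrite -lee_fin -ball_capE// fineK ?ball_fin_num//.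
by apply: le_measure; rewrite ?inE//; exact: measurableI.
Qed.

Lemma occupation_ge (A : set M) x r (eta : R) : measurable A -> 0 < r ->
  (eta <= occupation mu (ball x r) A) =
  (eta%:E * mu (ball x r) <= mu (A `&` ball x r))%E.
Proof.
move=> mA r0; rewrite ler_pdivlMr ?fine_ball_gt0//.
by rewrite ball_capE// -[mu (ball x r)]fineK ?ball_fin_num// -EFinM lee_fin.
Qed.

Section admissible_functions.
Variable E : dirichletForm mu.
Variable J : R.-ker M ~> M.
Variables (x0 : M) (rho : R) (f u : M -> R).
Hypothesis rho0 : 0 < rho.
Hypothesis hu : admissible E x0 rho f u.

Let mb x r : measurable (ball x r : set M). Proof. exact: ball_borel mms _ _. Qed.

Lemma admissible_measurable : measurable_fun [set: M] u.
Proof. by case: hu => _ _ /sub_Lfun_mfun; rewrite inE. Qed.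

Lemma measurable_superlevel a : measurable [set x | a <= u x].
Proof.
rewrite -[X in measurable X]setTI.
have -> : [set x | a <= u x] = u @^-1` `[a, +oo[.
  by apply/seteqP; split=> x /=; rewrite in_itv/= andbT.
exact: admissible_measurable.
Qed.

Lemma TT_dichotomy :
  TT mu J x0 rho f u = +oo%E \/ exists2 t : R, 0 <= t & TT mu J x0 rho f u = t%:E.
Proof.
have : (0 <= TT mu J x0 rho f u)%E.
  apply: adde_ge0; apply: ess_sup_on_ge0; try exact: mb.
  - by apply: (ball_gt0 mms); rewrite mulr_gt0.
  - by move=> x; exact: integral_ge0.
  - exact: (ball_gt0 mms).
  - by move=> x; rewrite lee_fin.
case: (TT _ _ _ _ _ _) => [t| |]//; last by left.
by rewrite lee_fin => t0; right; exists t.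
Qed.

Lemma ess_inf_admissible r : 0 < r -> r <= rho -> exists2 e : R, 0 <= e &
  ess_inf_on mu (ball x0 r) (EFin \o u) = e%:E.
Proof.
move=> r0 rrho; case: hu => _ _ /Lfun_infty_bounded[K K0 uK] u0 _.
have : (0 <= ess_inf_on mu (ball x0 r) (EFin \o u))%E.
  apply: ess_inf_on_ge; apply: filterS u0 => x + xr.
  rewrite lee_fin; apply; move: xr; apply: sub_ball.
  by rewrite mdistxx add0r.
have : (ess_inf_on mu (ball x0 r) (EFin \o u) <= K%:E)%E.
  apply: ess_inf_on_le; rewrite ?ball_gt0//.
  by apply: filterS uK => x; apply: le_trans; exact: ler_norm.
case: (ess_inf_on _ _ _) => [e| |]//.
by rewrite !lee_fin => _ e0; exists e.
Qed.

Lemma measurable_admissible_powR p :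
  measurable_fun [set: M] (fun x => (u x `^ p)%:E).
Proof.
apply/measurable_EFinP; apply: measurableT_comp (measurable_powR p) _.
exact: admissible_measurable.
Qed.

Lemma integral_powR_fin p r : 0 <= p -> r <= rho ->
  (\int[mu]_(x in ball x0 r) (u x `^ p)%:E < +oo)%E.
Proof.
move=> p0 rrho; case: hu => _ _ /Lfun_infty_bounded[K K0 uK] u0 _.
apply: (@le_lt_trans _ _ (\int[mu]_(x in ball x0 r) (cst (K `^ p)%:E x))%E).
  apply: ae_ge0_le_integral => //.
  - by move=> x _; rewrite lee_fin powR_ge0.
  - exact/measurable_funTS/measurable_admissible_powR.
  - by move=> x _; rewrite lee_fin powR_ge0.
  apply: filterS2 u0 uK => x u0 uK xr; rewrite lee_fin.
  have ux : 0 <= u x.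
    by apply: u0; move: xr; apply: sub_ball; rewrite mdistxx add0r.
  apply: ge0_ler_powR; rewrite ?nnegrE//.
  by rewrite -(ger0_norm ux).
by rewrite integral_cst// lte_mul_pinfty// ?ball_fin// lee_fin powR_ge0.
Qed.

Lemma markov_average a p r : 0 < a -> 0 < p -> 0 < r -> r <= rho ->
  a * occupation mu (ball x0 r) [set x | a <= u x] `^ p^-1 <=
  ((fine (mu (ball x0 r)))^-1 * \int[mu]_(x in ball x0 r) (u x `^ p)) `^ p^-1.
Proof.
move=> a0 p0 r0 rrho.
set A := [set x | a <= u x]; have mA : measurable A := measurable_superlevel a.
have b0 := fine_ball_gt0 x0 r0.
have -> : a = (a `^ p) `^ p^-1 by rewrite -powRrM mulfV ?gt_eqF// powRr1// ltW.
rewrite -powRM ?powR_ge0 ?occupation_ge0//.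
apply: ge0_ler_powR; rewrite ?nnegrE ?invr_ge0 ?(ltW p0)//.
- by rewrite mulr_ge0 ?powR_ge0 ?occupation_ge0.
- by rewrite mulr_ge0 ?invr_ge0 ?(ltW b0)//; apply: Rintegral_ge0 => x _; exact: powR_ge0.
rewrite /occupation mulrA mulrC ler_pM2l ?invr_gt0//.
have fin := integral_powR_fin (ltW p0) rrho.
rewrite -lee_fin /Rintegral fineK; last first.
  by rewrite ge0_fin_numE// integral_ge0// => x _; rewrite lee_fin powR_ge0.
rewrite EFinM -ball_capE//.
have mAB : measurable (A `&` ball x0 r) by exact: measurableI.
rewrite -integral_cst//.
apply: (@le_trans _ _ (\int[mu]_(x in A `&` ball x0 r) (u x `^ p)%:E)%E).
  apply: ge0_le_integral => //.
  - by move=> x _; rewrite lee_fin powR_ge0.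
  - exact/measurable_funTS/measurable_admissible_powR.
  move=> x [Ax _]; rewrite lee_fin; apply: ge0_ler_powR; rewrite ?nnegrE ?(ltW p0) ?(ltW a0)//.
  by apply: le_trans Ax; exact: ltW.
apply: ge0_subset_integral => //.
- exact/measurable_funTS/measurable_admissible_powR.
- by move=> x _; rewrite lee_fin powR_ge0.
Qed.

End admissible_functions.
End preliminaries.

Section implications.
Context {R : realType} {d : measure_display} {M : metricMeasurableType R d}.
Variable mu : {measure set M -> \bar R}.
Hypothesis mms : metric_measure_space mu.
Variable w : M -> R -> R.
Hypothesis hw : scale_function w.
Variable E : dirichletForm mu.
Variable J : R.-ker M ~> M.
Variable Rbar : \bar R.

(** This rests on [ln (1 / om) <= 1 / om]. *)
Lemma expR_le_powR (om p H : R) : 0 < om <= 1 -> 0 < p -> 1 <= H ->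
  expR (- ((ln H + p^-1) / om)) <= om `^ p^-1 / H.
Proof.
move=> /andP[om0 om1] p0 H1.
have H0 : 0 < H by apply: lt_le_trans H1.
have HE : H = expR (ln H) by rewrite lnK// posrE.
rewrite /powR gt_eqF// [X in _ <= _ / X]HE -expRN -expRD ler_expR.
have lnH : 0 <= ln H by rewrite ln_ge0.
have p1 : 0 < p^-1 by rewrite invr_gt0.
have om1' : 1 <= om^-1 by rewrite invf_ge1.
have lnom : - ln om <= om^-1.
  rewrite -lnV ?posrE//; apply: le_trans (ltW (ltr_pwDl ltr01 (lexx _))) _.
  have := @expR_ge1Dx R (ln om^-1).
  by rewrite lnK// posrE invr_gt0.
rewrite mulrDl; have := ler_wpM2l (ltW p1) lnom; have := ler_peMr lnH om1'; lra.
Qed.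

(** Bounding the mean of [u ^ p] from below by Markov's inequality leaves
    [a * om `^ p^-1 / CH] as a lower bound of [ess inf u + w T]. *)
Lemma wEH_wEH2 : wEH E J w Rbar -> wEH2 E J w Rbar.
Proof.
move=> [p [delta [sigma [CH [[/andP[p0 p1] /andP[d0 d1] s01 CH1] h]]]]].
have CH0 : 0 < CH by apply: lt_le_trans CH1.
exists sigma, delta, (ln CH + p^-1); split.
  by split; rewrite ?d0//; apply: ltr_wpDl; rewrite ?ln_ge0 ?invr_gt0.
move=> x0 rho r rho0 rhoR r0 rrho a f u a0 adm /=; set om := occupation _ _ _.
have rrho' : r <= rho.
  by apply: (le_trans (ltW rrho)); rewrite ler_piMl ?ltW.
have := h x0 r rho r0 (ltW rrho) rhoR f u adm.
have [e e0 ->] := ess_inf_admissible mms adm r0 rrho'.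
have wr := scale_gt0 hw x0 r0.
have [->|[t t0 ->]] := TT_dichotomy mms J x0 f u rho0.
  by rewrite gt0_muley ?lte_fin// => _; rewrite addeC leNye.
rewrite -!EFinM -EFinD lee_fin => harnack.
have := markov_average mms adm a0 p0 r0 rrho'; rewrite -/om => /le_trans /(_ harnack).
rewrite lee_fin; case: ifPn => [_ _|om_neq0 bound].
  by rewrite mulr0 sub0r; apply: le_trans e0; rewrite oppr_le0 mulr_ge0// ltW.
have om0 : 0 < om by rewrite lt_neqAle eq_sym om_neq0 occupation_ge0.
have om1 : om <= 1.
  by apply: occupation_le1 => //; exact: measurable_superlevel adm _.
rewrite lerBlDr; apply: (@le_trans _ _ (a * (om `^ p^-1 / CH))).
  by rewrite ler_pM2l// expR_le_powR// om0.
by rewrite mulrA ler_pdivrMr// [leRHS]mulrC.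
Qed.

(** Half of the lower bound [a * expR (- (C / eta))] absorbs the tail term. *)
Lemma wEH2_wEH3 : wEH2 E J w Rbar -> wEH3 E J w Rbar.
Proof.
move=> [sigma [delta [C [[s01 /andP[d0 d1] C0] h]]]].
exists sigma, (delta / 2), (fun eta => expR (- (C / eta)) / 2); split.
  split=> //; first by apply/andP; split; lra.
  move=> eta /andP[eta0 _]; have : expR (- (C / eta)) <= 1.
    by rewrite expR_le1 oppr_le0 divr_ge0// ltW.
  by have := expR_gt0 (- (C / eta)); lra.
move=> x0 rho r rho0 rhoR r0 rrho eta f u a /andP[eta0 eta1] adm a0 om_ge small.
have rrho' : r < delta * rho.
  by apply: (le_lt_trans rrho); rewrite ltr_pM2r//; lra.
have := h x0 rho r rho0 rhoR r0 rrho' a f u a0 adm; rewrite /=.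
set om := occupation _ _ _ in om_ge *.
have om0 : 0 < om by apply: lt_le_trans om_ge.
rewrite gt_eqF//; apply: le_trans.
have wr := scale_gt0 hw x0 r0.
have [E0|[t t0 E0]] := TT_dichotomy mms J x0 f u rho0; move: small; rewrite E0.
  by rewrite gt0_muley ?lte_fin.
rewrite -!EFinM -EFinB !lee_fin => small.
have : expR (- (C / eta)) <= expR (- (C / om)).
  by rewrite ler_expR lerN2 ler_pM2l// lef_pV2.
by move=> /(ler_wpM2l (ltW a0)); lra.
Qed.

(** The concentric ball of radius [4 * r] inherits the density up to the factor
    [C ^ 2].  If the tail term is too large there for wEH3, then, the scale
    function being comparable at [r] and [4 * r], it exceeds the main term of
    the claimed lower bound, which is therefore negative. *)
Lemma wEH3_wEH1 : volume_doubling mu -> wEH3 E J w Rbar -> wEH1 E J w Rbar.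
Proof.
move=> /(doubling_const)[C C2 dbl] [sigma [delta [F [[s01 /andP[d0 d1] F01] h]]]].
have [K K1 wK] := scale_comparable hw.
have C0 : 0 < C by lra.
have CC : 1 <= C ^+ 2 by apply: exprn_ege1; lra.
have eta01 eta : 0 < eta <= 1 -> 0 < eta / C ^+ 2 <= 1.
  move=> /andP[eta0 eta1]; rewrite divr_gt0 ?exprn_gt0//=.
  by rewrite ler_pdivrMr ?exprn_gt0// mul1r; apply: le_trans CC.
exists sigma, (delta / 8), (fun eta => F (eta / C ^+ 2) / (2 * K)); split.
  split=> //; first by apply/andP; split; lra.
  move=> eta /eta01/F01/andP[F0 F1]; rewrite divr_gt0 ?mulr_gt0//=; last by lra.
  by rewrite ltr_pdivrMr; lra.
move=> x0 rho r rho0 rhoR r0 rrho f eta u a eta1 adm a0 om_ge.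
have rrho4 : 4 * r <= delta * rho.
  have : 0 < delta * rho by rewrite mulr_gt0.
  by move: rrho; rewrite mulrAC; lra.
have rrho1 : 4 * r <= rho.
  by apply: (le_trans rrho4); rewrite ler_piMl ?ltW.
have r40 : 0 < 4 * r by lra.
have mA := measurable_superlevel adm a.
set A := [set x | a <= u x] in om_ge mA.
have om4 : eta / C ^+ 2 <= occupation mu (ball x0 (4 * r)) A.
  move: om_ge; rewrite !occupation_ge// => om_ge.
  have mb s : measurable (ball x0 s : set M) by exact: ball_borel mms _ _.
  apply: (@le_trans _ _ (mu (A `&` ball x0 r))); last first.
    apply: le_measure; rewrite ?inE//; try exact: measurableI.
    by apply: setIS; apply: sub_ball; rewrite mdistxx; lra.
  apply: le_trans om_ge; rewrite EFinM -muleA; apply: lee_wpmul2l.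
    by rewrite lee_fin; case/andP: eta1 => /ltW.
  rewrite lee_pdivrMl ?exprn_gt0//.
  by apply: (doubling_sub mms C2 dbl) => //; rewrite mdistxx expr2; lra.
have := h x0 rho (4 * r) rho0 rhoR r40 rrho4 (eta / C ^+ 2) f u a (eta01 _ eta1) adm a0 om4.
have /andP[] := F01 _ (eta01 _ eta1); set F' := F _ => F'0 F'1.
have [e e0 ->] := ess_inf_admissible mms adm r40 rrho1.
have wr := scale_gt0 hw x0 r0; have wr4 := scale_gt0 hw x0 r40.
have [->|[t t0 ->]] := TT_dichotomy mms J x0 f u rho0.
  by rewrite !gt0_muley ?lte_fin// => _; rewrite addeC ltNyr.
rewrite -!EFinM -EFinB !lee_fin !lte_fin.
have wle : w x0 (4 * r) * t <= K * (w x0 r * t).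
  by rewrite mulrA ler_wpM2r// wK// mdistxx ltW.
have K0 : 0 < K by lra.
have eps_le : F' / (2 * K) * a <= F' * a / 2.
  rewrite mulrAC ler_pdivrMr ?mulr_gt0//.
  have := mulr_gt0 F'0 a0 => Fa; rewrite mulrA divfK ?pnatr_eq0//.
  by rewrite ler_peMr// ltW.
have Fa := mulr_gt0 F'0 a0; have wt : 0 <= w x0 r * t by rewrite mulr_ge0// ltW.
have [small /(_ isT)|large _] := leP (w x0 (4 * r) * t) (F' * a).
  by lra.
apply: lt_le_trans e0; rewrite subr_lt0 mulrAC ltr_pdivrMr ?mulr_gt0//.
have : 0 <= K * (w x0 r * t) by rewrite mulr_ge0// ltW.
by lra.
Qed.

Lemma wEH3_wEH4 : wEH3 E J w Rbar -> wEH4 E J w Rbar.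
Proof.
move=> [sigma [delta [F [[s01 /andP[d0 d1] F01] h]]]].
have half : 0 < (2^-1 : R) <= 1 by apply/andP; split; lra.
have /andP[F0 F1] := F01 _ half.
exists sigma, (F 2^-1 / 2), delta; split.
  by split=> //; apply/andP; split=> //; lra.
move=> x0 rho rho0 rhoR f u a adm a0 om_ge small.
have r0 : 0 < delta * rho by rewrite mulr_gt0.
have Fa : ((F 2^-1 / 2 * a)%:E <= (F 2^-1 * a)%:E)%E.
  by rewrite lee_fin ler_pM2r//; lra.
apply: (le_trans Fa).
apply: le_trans (h x0 rho (delta * rho) rho0 rhoR r0 (lexx _) _ f u a half adm a0 om_ge _) _.
  exact: le_trans Fa.
by apply: ess_inf_onS; apply: sub_ball; rewrite mdistxx; lra.
Qed.

End implications.

(** * Propagation of lower bounds through growing sets *)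

Lemma ae_forall_countable {R : realType} {d : measure_display}
    {M : metricMeasurableType R d} (mu : {measure set M -> \bar R})
    (I : countType) (P : I -> M -> Prop) :
  (forall i, {ae mu, forall x, P i x}) -> {ae mu, forall x, forall i, P i x}.
Proof.
move=> h.
have : {ae mu, forall x, forall n : nat, oapp (fun i => P i x) True (unpickle n)}.
  by apply: ae_foralln => n; case: (unpickle n) => [i|]/=; [exact: h|exact: aeW].
by apply: filterS => x hx i; have := hx (pickle i); rewrite pickleK.
Qed.

Section growing_sets.
Context {R : realType} {d : measure_display} {M : metricMeasurableType R d}.
Variable mu : {measure set M -> \bar R}.
Hypothesis mms : metric_measure_space mu.
Variable C : R.
Hypothesis C2 : 2 <= C.
Hypothesis doubling : forall (x : M) (r : R), 0 < r ->
  (mu (ball x (2 * r)) <= C%:E * mu (ball x r))%E.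
Variables (x0 : M) (r : R) (u : M -> R) (kappa m : R).
Hypotheses (r0 : 0 < r) (kappa01 : 0 < kappa < 1) (m0 : 0 <= m).
Hypothesis spread : forall (G : set M) (y : M) (s b : R), measurable G ->
  mdist x0 y <= 3 * r -> 0 < s -> s <= 2 * r -> m < kappa * b ->
  {ae mu, forall x, G x -> b <= u x} ->
  ((C^-1 ^+ 7)%:E * mu (ball y s) <= mu (G `&` ball y s))%E ->
  {ae mu, forall x, ball y (4 * s) x -> kappa * b <= u x}.

Let C0 : 0 < C. Proof. by move: C2; lra. Qed.
Let c0 : 0 < C^-1. Proof. by rewrite invr_gt0. Qed.
Let c1 : C^-1 < 1. Proof. by rewrite invf_lt1//; move: C2; lra. Qed.
Let k0 : 0 < kappa. Proof. by case/andP: kappa01. Qed.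
Let k1 : kappa < 1. Proof. by case/andP: kappa01. Qed.
Let mb x s : measurable (ball x s : set M). Proof. exact: ball_borel mms _ _. Qed.

Let shrink N b : m < kappa ^+ N.+1 * b -> 0 < b /\ m < kappa * b.
Proof.
move=> mN; have b0 : 0 < b.
  by rewrite -(pmulr_rgt0 _ (exprn_gt0 N.+1 k0)); exact: le_lt_trans mN.
split=> //; apply: (lt_le_trans mN); rewrite ler_pM2r// exprS.
by rewrite ler_piMr ?(ltW k0)// exprn_ile1// ltW.
Qed.

(** The hypothesis [spread] is what wEH1 says in balls of varying centres, with
    [m] for the tail term.  In the step from [N] to [N + 1], either [E] is already large enough for the
    case [N], or its dense cover [U] is, with [kappa * b] as lower bound, since
    [mu U >= C ^ 2 * mu E].  When [E] is not, a dense ball of radius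
    [r / 4 ^ k] has measure at least [C ^ -(2 k + 2)] times that of [B_r] and at
    most [C ^ 4 * mu E], which forces [k > N]; so [U] stays in the ball of the
    case [N].  For [N = 0], [E] has density at least [C^-7] in [B_(2 r)]. *)
Lemma growing_sets (N : nat) (E : set M) (b : R) : measurable E ->
  E `<=` ball x0 (r * (1 + 4^-1 ^+ N)) ->
  ((C^-1 ^+ (2 * N + 6))%:E * mu (ball x0 r) <= mu E)%E ->
  {ae mu, forall x, E x -> b <= u x} -> m < kappa ^+ N.+1 * b ->
  {ae mu, forall x, ball x0 r x -> kappa ^+ N.+1 * b <= u x}.
Proof.
have [q qdense] := dense_sequence x0 mms.
elim: N E b => [|N IH] E b mE Eball Ebig uE mN.
  rewrite expr1 in mN *; rewrite expr0 in Eball.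
  have E2 : E `&` ball x0 (2 * r) = E.
    by apply/setIidl; apply: subset_trans Eball _; apply: sub_ball; rewrite mdistxx; lra.
  have d0 : mdist x0 x0 <= 3 * r by rewrite mdistxx mulr_ge0// ltW.
  have r20 : 0 < 2 * r by rewrite mulr_gt0.
  have big2 : ((C^-1 ^+ 7)%:E * mu (ball x0 (2 * r)) <= mu (E `&` ball x0 (2 * r)))%E.
    rewrite E2; apply: le_trans Ebig.
    rewrite muln0 add0n exprSr EFinM -muleA; apply: lee_wpmul2l.
      by rewrite lee_fin exprn_ge0// ltW.
    by rewrite lee_pdivrMl//; exact: doubling.
  have h := spread mE d0 r20 (lexx _) mN uE big2.
  by apply: filterS h => x + xr; apply; move: xr; apply: sub_ball; rewrite mdistxx; move: r0; lra.
have [b0 mb1] := shrink mN.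
have q40 : 0 < 4^-1 ^+ N.+1 :> R by rewrite exprn_gt0.
have q4S : 4^-1 ^+ N = 4 * 4^-1 ^+ N.+1 :> R by rewrite exprS mulrA divff ?mul1r.
have q41 : 4^-1 ^+ N.+1 <= 1 :> R by rewrite exprn_ile1//; lra.
have [big|small] := leP ((C^-1 ^+ (2 * N + 6))%:E * mu (ball x0 r))%E (mu E).
  have kk : kappa ^+ N.+2 * b <= kappa ^+ N.+1 * b.
    by rewrite ler_pM2r// exprS ler_piMl ?exprn_ge0// ltW.
  have h := IH E b mE _ big uE (lt_le_trans mN kk).
  apply: filterS (h _) => [x + xr|]; first by move=> /(_ xr); exact: le_trans.
  apply: subset_trans Eball _; apply: sub_ball; rewrite mdistxx add0r q4S.
  by rewrite ler_pM2l//; lra.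
pose eta := C^-1 ^+ 4.
have eta0 : 0 < eta by rewrite exprn_gt0.
have etaC : eta * C ^+ 2 = C^-1 ^+ 2.
  rewrite /eta (exprD _ 2 2) -mulrA -exprMn mulVf ?gt_eqF// expr1n mulr1//.
have etaC1 : eta * C ^+ 2 < 1 by rewrite etaC exprn_ilt1// ltW.
have finE : (mu E < +oo)%E.
  apply: lt_trans small _; rewrite lte_mul_pinfty// ?ball_fin//.
  by rewrite lee_fin exprn_ge0// ltW.
pose U := dense_cover mu E q r eta.
have mU : measurable U by exact: measurable_dense_cover.
have rk k : 0 < r / 4 ^+ k <= r.
  rewrite divr_gt0 ?exprn_gt0//= ler_pdivrMr ?exprn_gt0//.
  by apply: ler_peMr; [exact: ltW|apply: exprn_ege1; lra].
(* a dense ball is small, because [E] is, and close to [E] *)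
have dense i : dense_ball mu E q r eta i ->
    [/\ (N < i.2)%N, mdist x0 (q i.1) <= 3 * r &
        exists2 z, E z & mdist (q i.1) z < r / 4 ^+ i.2].
  case: i => n k di; have /andP[rk0 rk1] := rk k.
  have [z [Ez /in_ball zk]] : (E `&` grid_ball q r (n, k)) !=set0.
    apply/set0P/eqP => E0; move: di; rewrite /dense_ball E0 measure0.
    by rewrite leNgt mule_gt0// ?lte_fin// ball_gt0.
  have x0q : mdist x0 (q n) <= 3 * r.
    have /in_ball := Eball _ Ez; have := metric_triangle x0 z (q n).
    rewrite [mdist z _]metric_sym.
    have : r * (1 + 4^-1 ^+ N.+1) <= 2 * r by rewrite mulrC ler_pM2r//; lra.
    by move: zk; rewrite /=; lra.
  split=> //; last by exists z.
  have far : (mu (ball x0 r) <= (C ^+ (2 * k.+1))%:E * mu (grid_ball q r (n, k)))%E.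
    apply: (doubling_sub mms C2 doubling) => //=.
    rewrite exprM (_ : 2 ^+ 2 = 4 :> R); last by rewrite expr2; lra.
    have -> : 4 ^+ k.+1 * (r / 4 ^+ k) = 4 * r.
      by rewrite exprS; field; rewrite expf_neq0.
    by move: x0q; lra.
  have gk : (mu (grid_ball q r (n, k)) = (fine (mu (grid_ball q r (n, k))))%:E)%E.
    by rewrite fineK// ball_fin_num.
  have gk0 : 0 < fine (mu (grid_ball q r (n, k))) by rewrite fine_ball_gt0.
  have : (eta%:E * mu (grid_ball q r (n, k)) <
      (C^-1 ^+ (2 * N + 6))%:E * ((C ^+ (2 * k.+1))%:E * mu (grid_ball q r (n, k))))%E.
    apply: (le_lt_trans di); apply: (@le_lt_trans _ _ (mu E)).
      apply: le_measure; rewrite ?inE//.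
      by apply: measurableI => //; exact: mb.
    apply: (lt_le_trans small); apply: lee_wpmul2l => //.
    by rewrite lee_fin exprn_ge0// ltW.
  rewrite gk -!EFinM lte_fin mulrA ltr_pM2r// /eta => lt1.
  rewrite /= ltnNge; apply/negP => kN; move: lt1; apply/negP; rewrite -leNgt.
  have NkE : (2 * N + 6 = 4 + (2 * k.+1 + 2 * (N - k)))%N by clear -kN; lia.
  rewrite NkE.
  rewrite exprD -mulrA; apply: ler_piMr; first by rewrite exprn_ge0// ltW.
  rewrite exprD mulrAC -exprMn mulVf ?gt_eqF// expr1n mul1r.
  by rewrite exprn_ile1// ltW.
have sparse0 n : ~ dense_ball mu E q r eta (n, 0%N) by move=> /dense[].
have Ugrow := le_dense_cover mms C2 doubling mE finE r0 qdense eta0 etaC1 sparse0.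
rewrite etaC -/U in Ugrow.
rewrite exprSr -mulrA; apply: (IH U) => //.
- move=> y [[n k] /dense[/= Nk _ [z Ez qz]] /in_ball/= qy].
  have /in_ball x0z := Eball _ Ez; apply/in_ball.
  have := metric_triangle x0 z y; have := metric_triangle z (q n) y.
  rewrite [mdist z (q n)]metric_sym q4S.
  have : r / 4 ^+ k <= r * 4^-1 ^+ N.+1.
    by rewrite -exprVn ler_pM2l//; apply: ler_wiXn2l => //; lra.
  have : 0 < r * 4^-1 ^+ N.+1 by rewrite mulr_gt0.
  by move: x0z qz qy; rewrite !mulrDr; lra.
- have := le_trans Ebig Ugrow; rewrite mulnS -addnA.
  by rewrite exprD EFinM -muleA lee_pmul2l ?lte_fin ?exprn_gt0.
- have h : {ae mu, forall x, forall i : nat * nat,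
      dense_ball mu E q r eta i -> grid_ball q r i x -> kappa * b <= u x}.
    apply: ae_forall_countable => -[n k].
    have [di|ndi] := pselect (dense_ball mu E q r eta (n, k)); last exact: aeW.
    have [_ /= x0q _] := dense _ di.
    have /andP[rk0 rk1] := rk k.
    have rk2 : r / 4 ^+ k <= 2 * r by lra.
    have big : ((C^-1 ^+ 7)%:E * mu (ball (q n) (r / 4 ^+ k)) <=
        mu (E `&` ball (q n) (r / 4 ^+ k)))%E.
      apply: le_trans di; apply: lee_wpmul2r => //; rewrite lee_fin.
      by apply: ler_wiXn2l => //; exact: ltW.
    have h := spread mE x0q rk0 rk2 mb1 uE big.
    apply: filterS h => x + _ xk; apply; move: xk; apply: sub_ball => /=.
    by rewrite mdistxx; lra.
  by apply: filterS h => x hx [i di ix]; exact: hx ix.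
- by rewrite mulrA -exprSr.
Qed.

End growing_sets.

(** * From level set decay to integrability *)

Section layers.
Context {R : realType} {d : measure_display} {T : measurableType d}.
Variable mu : {measure set T -> \bar R}.
Variables (B : set T) (u : T -> R) (C lambda L p K : R).
Hypotheses (mB : measurable B) (mu_ : measurable_fun [set: T] u).
Hypotheses (C2 : 2 <= C) (lambda1 : 1 < lambda) (L0 : 0 < L) (p0 : 0 < p).
Hypothesis lambdaC : lambda `^ p <= C.
Hypothesis u_bounded : {ae mu, forall x, B x -> 0 <= u x <= K}.
Hypothesis decay : forall N : nat,
  (mu ([set x | (lambda ^+ N.+1 * L <= u x)%R] `&` B)
   <= (C^-1 ^+ (2 * N))%:E * mu B)%E.

Let layer n := [set x | 0 <= u x < lambda ^+ n.+1 * L] `&` B.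

Let mlayer n : measurable (layer n).
Proof.
apply: measurableI => //; rewrite -[X in measurable X]setTI.
have -> : [set x | 0 <= u x < lambda ^+ n.+1 * L] =
    u @^-1` `[0, lambda ^+ n.+1 * L[ by apply/seteqP; split=> x /=; rewrite in_itv.
exact: mu_.
Qed.

Let mF D : measurable_fun D (fun x => (u x `^ p)%:E).
Proof.
apply: measurable_funTS; apply/measurable_EFinP.
exact: measurableT_comp (measurable_powR p) mu_.
Qed.

Let lambda0 : 0 < lambda. Proof. by move: lambda1; lra. Qed.

Let powRX n : (lambda ^+ n * L) `^ p = (lambda `^ p) ^+ n * L `^ p.
Proof.
rewrite powRM ?exprn_ge0 ?(ltW lambda0) ?(ltW L0)//; congr (_ * _).
elim: n => [|n IH]; first by rewrite !expr0 powR1.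
by rewrite !exprS powRM ?exprn_ge0 ?(ltW lambda0)// IH.
Qed.

(** Going from one layer to the next multiplies the values of [u ^ p] by at most
    [C] and divides the bound on its measure by [C ^ 2], hence a geometric
    series of ratio at most [1 / 2]; [3 - 2 * 2^-1 ^+ n] is [1] plus the sum of
    [2^-1 ^+ j] over [j < n]. *)
Lemma integral_layer n :
  (\int[mu]_(x in layer n) (u x `^ p)%:E <=
   ((lambda `^ p) ^+ 2 * L `^ p * (3 - 2 * 2^-1 ^+ n))%:E * mu B)%E.
Proof.
set Lam := lambda `^ p; have Lam1 : 1 <= Lam.
  by rewrite /Lam -(powRr0 lambda); apply: ler_powR => //; exact: ltW.
have Lp0 : 0 <= L `^ p by exact: powR_ge0.
have bound D (a : R) : measurable D -> D `<=` [set x | 0 <= u x <= a] ->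
    (\int[mu]_(x in D) (u x `^ p)%:E <= (a `^ p)%:E * mu D)%E.
  move=> mD Da; rewrite -integral_cst//; apply: ge0_le_integral => //.
  - by move=> x _; rewrite lee_fin powR_ge0.
  - by move=> x Dx; rewrite lee_fin; have /andP[ux0 uxa] := Da _ Dx;
      apply: ge0_ler_powR; rewrite ?nnegrE ?(ltW p0) ?(le_trans ux0).
elim: n => [|n IH].
  rewrite expr0; apply: le_trans (bound _ (lambda ^+ 1 * L) _ _) _ => //.
    by move=> x [/andP[ux /ltW ux1] _]; rewrite /= ux.
  rewrite powRX expr1 -/Lam; apply: (@le_trans _ _ ((Lam * L `^ p)%:E * mu B)%E).
    apply: lee_wpmul2l; first by rewrite lee_fin mulr_ge0//; lra.
    by apply: le_measure; rewrite ?inE// => x [].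
  apply: lee_wpmul2r => //; rewrite lee_fin.
  have : Lam * L `^ p <= Lam ^+ 2 * L `^ p.
    by rewrite ler_wpM2r// expr2 ler_peMl//; lra.
  by lra.
pose D := layer n.+1 `\` layer n.
have mD : measurable D by exact: measurableD.
have -> : layer n.+1 = layer n `|` D.
  rewrite /D setDUK// => x [/andP[ux ux1] Bx]; split=> //=; rewrite ux/=.
  apply: (lt_le_trans ux1); rewrite ler_pM2r//.
  by rewrite ler_weXn2l// ltW.
rewrite ge0_integral_setU//; last 2 first.
- by move=> x _; rewrite lee_fin powR_ge0.
- by rewrite disj_set2E; apply/eqP; rewrite -subset0 => x [nx [_ /(_ nx)]].
have DB : (mu D <= (C^-1 ^+ (2 * n))%:E * mu B)%E.
  apply: le_trans (decay n); apply: le_measure; rewrite ?inE//.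
    apply: measurableI => //; rewrite -[X in measurable X]setTI.
    have -> : [set x | lambda ^+ n.+1 * L <= u x] = u @^-1` `[lambda ^+ n.+1 * L, +oo[.
      by apply/seteqP; split=> x /=; rewrite in_itv/= andbT.
    exact: mu_.
  move=> x [[/andP[ux0 ux1] Bx] nx]; split=> //=; rewrite leNgt; apply/negP => ux2.
  by apply: nx; split=> //=; rewrite ux0.
have Dbound : (\int[mu]_(x in D) (u x `^ p)%:E <=
    (Lam ^+ 2 * L `^ p * 2^-1 ^+ n)%:E * mu B)%E.
  apply: le_trans (bound _ (lambda ^+ n.+2 * L) mD _) _.
    by move=> x [[/andP[ux0 /ltW ux1] _] _]; rewrite /= ux0.
  rewrite powRX -/Lam.
  apply: (@le_trans _ _ ((Lam ^+ n.+2 * L `^ p)%:E * ((C^-1 ^+ (2 * n))%:E * mu B))%E).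
    by apply: lee_wpmul2l => //; rewrite lee_fin mulr_ge0// exprn_ge0//; lra.
  rewrite muleA -EFinM; apply: lee_wpmul2r => //; rewrite lee_fin.
  have -> : Lam ^+ n.+2 * L `^ p * C^-1 ^+ (2 * n) =
      Lam ^+ 2 * L `^ p * (Lam * C^-1 ^+ 2) ^+ n.
    by rewrite (exprD Lam 2 n) exprMn exprM; ring.
  apply: ler_wpM2l; first by rewrite mulr_ge0// exprn_ge0//; lra.
  have C0 : 0 < C by move: C2; lra.
  apply: lerXn2r; rewrite ?nnegrE.
  - by apply: mulr_ge0; [lra|rewrite exprn_ge0// invr_ge0 ltW].
  - by rewrite invr_ge0.
  apply: (@le_trans _ _ (C * C^-1 ^+ 2)).
    by rewrite ler_wpM2r// exprn_ge0// invr_ge0 ltW.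
  by rewrite expr2 mulrA divff ?gt_eqF// mul1r lef_pV2 ?posrE.
apply: le_trans (leeD IH Dbound) _.
have LL0 : 0 <= Lam ^+ 2 * L `^ p by rewrite mulr_ge0// exprn_ge0//; lra.
rewrite -ge0_muleDl; last 2 first.
- rewrite lee_fin; apply: mulr_ge0 => //.
  have : 2^-1 ^+ n <= 1 :> R by rewrite exprn_ile1// invf_le1// ler1n.
  by lra.
- by rewrite lee_fin; apply: mulr_ge0 => //; rewrite exprn_ge0.
apply: lee_wpmul2r => //; rewrite -EFinD lee_fin (exprS 2^-1 n).
by rewrite -mulrDr; apply: ler_wpM2l => //; lra.
Qed.

Lemma integral_powR_decay :
  (\int[mu]_(x in B) (u x `^ p)%:E <= (3 * (lambda `^ p) ^+ 2 * L `^ p)%:E * mu B)%E.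
Proof.
have [n nK] : exists n, K < lambda ^+ n.+1 * L.
  have l1 : 0 < lambda - 1 by rewrite subr_gt0.
  have [n nP] : exists n, K / L / (lambda - 1) < n%:R.
    exists (Num.bound `|K / L / (lambda - 1)|).
    by apply: le_lt_trans (ler_norm _) _; rewrite archi_boundP.
  exists n; rewrite -ltr_pdivrMr//.
  have {}nP : K / L < n%:R * (lambda - 1) by rewrite -ltr_pdivrMr.
  apply: (lt_le_trans nP).
  have : 1 + n%:R * (lambda - 1) <= lambda ^+ n.
    elim: n {nP} => [|n IH]; first by rewrite expr0 mul0r addr0.
    rewrite exprS; apply: le_trans (ler_wpM2l (ltW lambda0) IH).
    rewrite -natr1 -subr_ge0.
    have -> : lambda * (1 + n%:R * (lambda - 1)) - (1 + (n%:R + 1) * (lambda - 1)) =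
      n%:R * (lambda - 1) ^+ 2 by ring.
    by rewrite mulr_ge0// sqr_ge0.
  have : lambda ^+ n <= lambda ^+ n.+1 by rewrite ler_weXn2l// ltW.
  by lra.
have mN : measurable (B `\` layer n) by exact: measurableD.
have N0 : mu (B `\` layer n) = 0%E.
  apply/negligibleP => //; apply: negligibleS u_bounded => x [Bx nx] /= /(_ Bx).
  move=> /andP[ux0 uxK]; apply: nx; split=> //=; rewrite ux0/=.
  exact: le_lt_trans nK.
rewrite (ge0_negligible_integral mN mB)//; last by move=> x _; rewrite lee_fin powR_ge0.
rewrite setDD (_ : B `&` layer n = layer n); last by apply/setIidr => x [].
apply: (le_trans (integral_layer n)); apply: lee_wpmul2r => //; rewrite lee_fin.
rewrite -[3 * _ * _]mulrA [3 * _]mulrC; apply: ler_wpM2l.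
  by rewrite mulr_ge0 ?exprn_ge0 ?powR_ge0.
by rewrite lerBlDr lerDl mulr_ge0// exprn_ge0.
Qed.

End layers.

(** * From the growth property to the integral Harnack inequality *)

Section crossover.
Context {R : realType} {d : measure_display} {M : metricMeasurableType R d}.
Variable mu : {measure set M -> \bar R}.
Hypothesis mms : metric_measure_space mu.
Variable w : M -> R -> R.
Hypothesis hw : scale_function w.
Variable E : dirichletForm mu.
Variable J : R.-ker M ~> M.
Hypothesis hJ : jump_kernel E J.
Variable Rbar : \bar R.

Let mb x s : measurable (ball x s : set M). Proof. exact: ball_borel mms _ _. Qed.

Lemma ae_le_measure (A B : set M) : measurable A -> measurable B ->
  {ae mu, forall x, A x -> B x} -> (mu A <= mu B)%E.
Proof.
move=> mA mB AB; rewrite (measureDI mu mA mB) [X in (X + _)%E](_ : _ = 0%E).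
  by rewrite add0e; apply: le_measure; rewrite ?inE//; exact: measurableI.
apply/negligibleP; first exact: measurableD.
by apply: negligibleS AB => x [Ax nBx] /= /(_ Ax).
Qed.

(** If [{u >= kappa ^ -(N + 1) L}] filled more of [B_r] than
    [C ^ -(2 N + 6)], then [growing_sets] would give [u >= L] almost everywhere
    on [B_r], against [L > ess inf u].  The radius is restricted to
    [delta / 8 * rho] so that wEH1 applies to all balls in play inside balls of
    radius [rho / 2] around their own centres. *)
Lemma wEH1_wEH : volume_doubling mu -> wEH1 E J w Rbar -> wEH E J w Rbar.
Proof.
move=> /doubling_const[C C2 dbl].
move=> [sigma [delta [eps [[s01 /andP[d0 d1] eps01] growth]]]].
have [K K1 wK] := scale_comparable hw.
have C0 : 0 < C by lra.
have c7 : 0 < C^-1 ^+ 7 <= 1.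
  rewrite exprn_gt0 ?invr_gt0//= exprn_ile1// ?invr_ge0 ?(ltW C0)//.
  by rewrite invf_le1//; lra.
have /andP[eps0 eps1] := eps01 _ c7.
pose kappa := eps (C^-1 ^+ 7) / 2.
have kappa01 : 0 < kappa < 1 by apply/andP; rewrite /kappa; split; lra.
have /andP[k0 k1] := kappa01.
have kV1 : 1 < kappa^-1 by rewrite invf_gt1.
have [n kC] : exists n, kappa^-1 <= C ^+ n.+2.
  set k := Num.bound kappa^-1; exists k.
  have kV : kappa^-1 <= k%:R by apply/ltW/archi_boundP; rewrite invr_ge0 ltW.
  have k2 : (k <= 2 ^ k.+2)%N.
    apply: leq_trans (ltnW (ltn_expl k (isT : 1 < 2)%N)) _.
    by rewrite leq_exp2l//; exact: leqW (leqnSn k).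
  apply: (le_trans kV); apply: (@le_trans _ _ (2 ^+ k.+2)).
    by rewrite -natrX ler_nat.
  by apply: lerXn2r; rewrite ?nnegrE// ltW.
pose p : R := n.+2%:R^-1.
have p0 : 0 < p by rewrite invr_gt0.
have p1 : p < 1 by rewrite invf_lt1// ltr1n.
have LamC : kappa^-1 `^ p <= C.
  have -> : C = (C ^+ n.+2) `^ p.
    by rewrite -powR_mulrn ?(ltW C0)// -powRrM mulfV// powRr1// ltW.
  by apply: ge0_ler_powR; rewrite ?nnegrE ?exprn_ge0 ?invr_ge0 ?(ltW p0) ?(ltW k0) ?(ltW C0).
pose H := (3 * (kappa^-1 `^ p) ^+ 2) `^ p^-1.
have Lam1 : 1 <= kappa^-1 `^ p.
  by have := ler_powR (ltW kV1) (ltW p0); rewrite powRr0.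
have H1 : 1 <= H.
  have base : 1 <= 3 * (kappa^-1 `^ p) ^+ 2.
    have : 1 <= (kappa^-1 `^ p) ^+ 2 by exact: exprn_ege1.
    by lra.
  have pV0 : 0 <= p^-1 by rewrite invr_ge0 ltW.
  by have := ler_powR base pV0; rewrite powRr0.
have H0 : 0 < H by lra.
have HK1 : 1 <= H * K by rewrite -[1]mulr1; apply: ler_pM.
have HK0 : 0 < H * K by lra.
exists p, (delta / 8), sigma, (H * K); split.
  by split=> //; apply/andP; split=> //; lra.
move=> x0 r rho r0 rrho rhoR f u adm.
have rho0 : 0 < rho.
  by have : 0 < delta / 8 * rho; [exact: lt_le_trans rrho|rewrite pmulr_rgt0// divr_gt0].
have drho : delta * rho <= rho / 4.
  by rewrite mulrC ler_pM2l//; apply: le_trans (ltW d1) _.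
have rrho8 : 8 * r <= delta * rho.
  by move: rrho; rewrite mulrAC ler_pdivlMr// mulrC.
have rrho' : r <= rho by lra.
have [e e0 eE] := ess_inf_admissible mms adm r0 rrho'; rewrite eE.
have wr := scale_gt0 hw x0 r0.
have [->|[t t0 tE]] := TT_dichotomy mms J x0 f u rho0.
  by rewrite gt0_muley ?lte_fin// addey// gt0_muley ?lte_fin ?leey.
rewrite tE -!EFinM lee_fin.
pose m := K * w x0 r * t.
have m0 : 0 <= m by rewrite /m !mulr_ge0// ?ltW//; lra.
have spread (G : set M) (y : M) (s b : R) : measurable G ->
    mdist x0 y <= 3 * r -> 0 < s -> s <= 2 * r -> m < kappa * b ->
    {ae mu, forall x, G x -> b <= u x} ->
    ((C^-1 ^+ 7)%:E * mu (ball y s) <= mu (G `&` ball y s))%E ->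
    {ae mu, forall x, ball y (4 * s) x -> kappa * b <= u x}.
  move=> mG x0y s0 s2r mkb uG Gbig.
  have b0 : 0 < b by rewrite -(pmulr_rgt0 _ k0); exact: le_lt_trans mkb.
  have sub1 : ball y (rho / 2) `<=` ball x0 rho.
    by apply: sub_ball; rewrite metric_sym; lra.
  have sub2 : ball y (3 / 4 * (rho / 2)) `<=` ball x0 (3 / 4 * rho).
    by apply: sub_ball; rewrite metric_sym; lra.
  have TTy : (TT mu J y (rho / 2) f u <= t%:E)%E.
    by rewrite -tE; exact: TT_sub adm.
  have rho2 : 0 < rho / 2 by rewrite divr_gt0.
  have rho2R : ((rho / 2)%:E < sigma%:E * Rbar)%E.
    by apply: le_lt_trans rhoR; rewrite lee_fin; lra.
  have sdelta : s < delta * (rho / 2).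
    by have : 0 < delta * rho; [rewrite mulr_gt0|rewrite mulrA; lra].
  have adm' := admissibleS mms sub1 adm.
  have mA := measurable_superlevel adm b.
  have occ : C^-1 ^+ 7 <= occupation mu (ball y s) [set x | b <= u x].
    rewrite occupation_ge//; apply: (le_trans Gbig).
    apply: ae_le_measure; [exact: measurableI|exact: measurableI|].
    by apply: filterS uG => x ub [/ub].
  have := growth y (rho / 2) s rho2 rho2R s0 sdelta f _ u b c7 adm' b0 occ.
  move=> low.
  suff /ess_inf_on_gt : ((kappa * b)%:E < ess_inf_on mu (ball y (4 * s)) (EFin \o u))%E.
    by apply: filterS => x /[apply]; rewrite lee_fin.
  apply: le_lt_trans low.
  have wy := scale_gt0 hw y s0.
  apply: (@le_trans _ _ ((eps (C^-1 ^+ 7) * b)%:E - (w y s)%:E * t%:E)%E); last first.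
    by apply: leeB => //; apply: lee_wpmul2l; rewrite ?lee_fin// ltW.
  rewrite -EFinM -EFinB lee_fin.
  have : w y s * t <= m.
    by rewrite /m ler_wpM2r// wK//; lra.
  by move: mkb; rewrite /kappa; lra.
have mA a := measurable_superlevel adm a.
have b0 := fine_ball_gt0 mms x0 r0.
(* [e + m] may vanish, and the level sets need a positive unit [L] *)
have above L : e + m < L ->
    ((fine (mu (ball x0 r)))^-1 * \int[mu]_(x in ball x0 r) (u x `^ p)) `^ p^-1 <= H * L.
  move=> eL; have L0 : 0 < L by apply: le_lt_trans eL; exact: addr_ge0.
  have mL : m < L by lra.
  have decay N : (mu ([set x | (kappa^-1 ^+ N.+1 * L <= u x)%R] `&` ball x0 r)
      <= (C^-1 ^+ (2 * N))%:E * mu (ball x0 r))%E.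
    apply: (@le_trans _ _ ((C^-1 ^+ (2 * N + 6))%:E * mu (ball x0 r))%E); last first.
      apply: lee_wpmul2r => //; rewrite lee_fin; apply: ler_wiXn2l; rewrite ?invr_ge0 ?(ltW C0) ?leq_addr//.
      by rewrite invf_le1//; lra.
    rewrite leNgt; apply/negP => big.
    have kL : kappa ^+ N.+1 * (kappa^-1 ^+ N.+1 * L) = L.
      by rewrite mulrA -exprMn mulfV ?gt_eqF// expr1n mul1r.
    have h : {ae mu, forall x, ball x0 r x -> L <= u x}.
      rewrite -kL; apply: (growing_sets mms C2 dbl r0 kappa01 m0 spread _ _ (ltW big)) => //.
      - exact: measurableI.
      - move=> x [_]; apply: sub_ball; rewrite mdistxx add0r mulrDr mulr1 lerDl.
        by rewrite mulr_ge0 ?exprn_ge0// ltW.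
      - by apply: aeW => x [].
      - by rewrite kL.
    have : (L%:E <= e%:E)%E.
      by rewrite -eE; apply: ess_inf_on_ge; apply: filterS h => x /[apply]; rewrite lee_fin.
    by rewrite lee_fin; lra.
  have [B BP uB] := Lfun_infty_bounded (let: And5 _ _ Lu _ _ := adm in Lu).
  have ubd : {ae mu, forall x, ball x0 r x -> 0 <= u x <= B}.
    case: adm => _ _ _ u0 _; apply: filterS2 u0 uB => x u0 uB xr.
    rewrite (le_trans (ler_norm _) uB) andbT; apply: u0; move: xr.
    by apply: sub_ball; rewrite mdistxx add0r.
  have := integral_powR_decay (mb x0 r) (admissible_measurable adm) C2 kV1 L0 p0
    LamC ubd decay.
  set I := (\int[mu]_(x in _) _)%E => intI.
  have I0 : (0 <= I)%E by apply: integral_ge0 => x _; rewrite lee_fin powR_ge0.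
  have Ifin : I \is a fin_num.
    rewrite ge0_fin_numE//; apply: (le_lt_trans intI).
    by rewrite lte_mul_pinfty// ?ball_fin// lee_fin !mulr_ge0 ?exprn_ge0 ?powR_ge0.
  have -> : H * L = (3 * (kappa^-1 `^ p) ^+ 2 * L `^ p) `^ p^-1.
    rewrite powRM ?powR_ge0 ?mulr_ge0 ?exprn_ge0 ?powR_ge0//; congr (_ * _).
    by rewrite -powRrM mulfV ?gt_eqF// powRr1// ltW.
  apply: ge0_ler_powR; rewrite ?nnegrE ?invr_ge0 ?(ltW p0)//.
  - by rewrite mulr_ge0 ?invr_ge0 ?(ltW b0)// fine_ge0.
  - by rewrite !mulr_ge0 ?exprn_ge0 ?powR_ge0.
  have bfin := ball_fin_num mms x0 r.
  rewrite ler_pdivrMl// mulrC -lee_fin EFinM fineK//.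
  by rewrite /Rintegral fineK.
apply: (@le_trans _ _ (H * (e + m))).
  apply/ler_addgt0Pr => z z0.
  have -> : H * (e + m) + z = H * (e + m + z / H) by field; rewrite gt_eqF.
  by apply: above; rewrite ltrDl divr_gt0.
rewrite -mulrA ler_pM2l// /m -[K * w x0 r * t]mulrA mulrDr lerD2r.
by rewrite ler_peMl.
Qed.

End crossover.

(** * The equivalence *)

Theorem theorem1p9 (R : realType) (d : measure_display)
  (M : metricMeasurableType R d) (mu : {measure set M -> \bar R})
  (mms : metric_measure_space mu)
  (Rbar : \bar R) (Rbar_gt0 : (0 < Rbar)%E) (Rbar_le : (Rbar <= diam M)%E)
  (w : M -> R -> R) (hw : scale_function w)
  (E : dirichletForm mu) (hE : form'_well_defined E)
  (J : R.-ker M ~> M) (hJ : jump_kernel E J)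
  (vd : volume_doubling mu) :
  [/\ wEH E J w Rbar <-> wEH1 E J w Rbar,
      wEH1 E J w Rbar <-> wEH2 E J w Rbar,
      wEH2 E J w Rbar <-> wEH3 E J w Rbar &
      [\/ wEH E J w Rbar, wEH1 E J w Rbar, wEH2 E J w Rbar
        | wEH3 E J w Rbar] -> wEH4 E J w Rbar].
Proof.
have h02 := @wEH_wEH2 R d M mu mms w hw E J Rbar.
have h23 := @wEH2_wEH3 R d M mu mms w hw E J Rbar.
have h31 := @wEH3_wEH1 R d M mu mms w hw E J Rbar vd.
have h10 := @wEH1_wEH R d M mu mms w hw E J hJ Rbar vd.
have h34 := @wEH3_wEH4 R d M mu w E J Rbar.
split; last by case=> ?; apply: h34; auto.
all: by split=> ?; auto.
Qed.
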